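(* For every natural number $n \geq 0$, the $\omega$-category $s^n(1)$ obtained by applying the cone construction $s$ (cone under an $\omega$-category) $n$ times to the terminal $\omega$-category $1$ is isomorphic, as an $\omega$-category, to the $n$th oriental $\mathcal{O}(n)$.
   Context: **$\omega$-categories.** ''$\omega$-category'' means small strict globular $\omega$-category: a globular set $X$ (sets $X_n$ with $s,t\colon X_{n+1}\to X_n$, $ss=st$, $ts=tt$) with identities $i\colon X_n\to X_{n+1}$ and compositions $\circ_n$ of $k$-cells for all $0\le n<k$, satisfying the usual axioms. For a $k$-cell $x$ and $n<k$, $s_nx,t_nx\in X_n$ are its iterated source and target, the pair $(s_nx,t_nx)$ is its $n$-boundary (also, $s_kx=t_kx=x$), and $y\circ_n x$ is defined when $t_n(x)=s_n(y)$. Cells $x,y$ of the same dimension are parallel if they are $0$-cells or $(sx,tx)=(sy,ty)$. $x\colon y\to z$ means $sx=y$, $tx=z$. For $a,b\in X_0$, $X(a,b)$ is the $\omega$-category whose $n$-cells are the $(n+1)$-cells of $X$ with $0$-boundary $(a,b)$, with composition $\circ_n$ given by $\circ_{n+1}$ in $X$. In this way $\omega$-categories are identified with categories enriched in $\omega\text{-}\mathbf{Cat}$ (with its cartesian product), enriched composition $X(b,c)\times X(a,b)\to X(a,c)$ being $\circ_0$. An isomorphism of $\omega$-categories is an invertible $\omega$-functor (map of globular sets preserving identities and compositions). **Conventions.** $\circ_n$ binds more tightly than $\circ_k$ when $n<k$. When cells of different dimensions are composed, the lower-dimensional one is replaced by the iterated identity on it (whiskering). **Lax coslice.** For an $\omega$-category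 $X$ and $a\in X_0$, the $\omega$-category $a/X$ is as follows. - $0$-cells $\boldsymbol{x}=(x,\bar x)$: pairs $x\in X_0$, $\bar x\colon a\to x$ in $X$. - $(n+1)$-cells $\boldsymbol{x}=(x,\bar x)$ with $i$-boundary $(\boldsymbol m_i,\boldsymbol p_i)=((m_i,\bar m_i),(p_i,\bar p_i))$ for $i\le n$ (so $(\boldsymbol m_n,\boldsymbol p_n)$ is a parallel pair of $n$-cells): for $n$ even, pairs $$x\colon m_n\to p_n,\quad \bar x\colon \bar p_{n-1}\circ_{n-1}\cdots\bar p_3\circ_3\bar p_1\circ_1 x\circ_0\bar m_0\circ_2\bar m_2\cdots\circ_n\bar m_n\to\bar p_n;$$ for $n$ odd, pairs $$x\colon m_n\to p_n,\quad \bar x\colon\bar m_n\to\bar p_n\circ_n\cdots\bar p_3\circ_3\bar p_1\circ_1 x\circ_0\bar m_0\circ_2\bar m_2\cdots\circ_{n-1}\bar m_{n-1}.$$ - Composition: if $\boldsymbol x,\boldsymbol y$ are $k$-cells with $k>n$, $t_n(\boldsymbol x)=s_n(\boldsymbol y)$, and common $i$-boundary $(\boldsymbol m_i,\boldsymbol p_i)$ for $i<n$, then $\boldsymbol y\circ_n\boldsymbol x$ is, for $n$ even, $$(y\circ_n x,\ \bar y\circ_{n+1}\bar p_{n-1}\circ_{n-1}\cdots\bar p_3\circ_3\bar p_1\circ_1 s_{n+1}y\circ_0\bar m_0\circ_2\bar m_2\cdots\circ_{n-2}\bar m_{n-2}\circ_n\bar x),$$ and for $n$ odd, $$(y\circ_n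 x,\ \bar y\circ_n\bar p_{n-2}\circ_{n-2}\cdots\bar p_3\circ_3\bar p_1\circ_1 t_{n+1}x\circ_0\bar m_0\circ_2\bar m_2\cdots\circ_{n-1}\bar m_{n-1}\circ_{n+1}\bar x).$$ - The identity on $(x,\bar x)$ is $(ix,i\bar x)$. **Right action.** For $a,b\in X_0$ there is an $\omega$-functor $a/X\times X(b,a)\to b/X$, $(\boldsymbol x,h)\mapsto\boldsymbol x\cdot h$, given on cells of every dimension by $\boldsymbol x\cdot h=(x,\bar x\circ_0 h)$ (with source $s\boldsymbol x\cdot sh$ and target $t\boldsymbol x\cdot th$ in positive dimension). This makes $a\mapsto a/X$ a right $X$-module. **Cone.** The cone $s(X)$ under $X$ is the collage of this right module: the $\omega\text{-}\mathbf{Cat}$-category (equivalently $\omega$-category) with object set $X_0+\{\star\}$ and homs $s(X)(x,y)=X(x,y)$ for $x,y\in X_0$; $s(X)(x,\star)=x/X$ for $x\in X_0$; $s(X)(\star,y)=\emptyset$ for $y\in X_0$; $s(X)(\star,\star)=1$; the non-trivial compositions are those of $X$ together with the action maps $y/X\times X(x,y)\to x/X$. **Orientals.** Let $[n]=\{0,\dots,n\}$ and let $[n]_j$ be the set of order-preserving injections $[j]\to[n]$. For $j>0$ and $a\in[n]_j$ set $a^+=\{a\delta_{2i}:0\le 2i\le j\}$ and $a^-=\{a\delta_{2i+1}:0\le 2i+1\le j\}$, subsets of $[n]_{j-1}$, where $\delta_k\colon[j-1]\to[j]$ is the order-preserving injection omitting $k$. For $\xi\subset[n]_j$, $\xi^\pm=\bigcup_{a\in\xi}a^\pm$.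 The $n$th oriental $\mathcal O(n)$ is the following $\omega$-category (its well-definedness is a theorem of Street). - $0$-cells are $i\in\{0,\dots,n\}$, identified with singletons $\{(i)\}\subset[n]_0$. - $(j+1)$-cells $\xi$ with successive $k$-boundaries $(\mu_k,\pi_k)$ for $k\le j$ (so $\mu_j,\pi_j$ is a parallel pair of $j$-cells) are finite subsets $\xi\subset[n]_{j+1}$ such that: (i) if $a\ne b\in\xi$ then $a^+\cap b^+=a^-\cap b^-=\emptyset$; (ii) $\pi_j=(\mu_j\cup\xi^+)\setminus\xi^-$ and $\mu_j=(\pi_j\cup\xi^-)\setminus\xi^+$ in $[n]_j$ (here a cell is denoted by its underlying subset; the boundary is part of the data of a cell). - For $(j+1)$-cells $\xi\colon x\to y$, $\zeta\colon y\to z$, the $\circ_j$-composite is $\zeta\cup\xi\colon x\to z$; for $(j+1)$-cells $\xi\colon x\to y$, $\zeta\colon w\to z$ with $t_i(\xi)=s_i(\zeta)$, $i<j$, the $\circ_i$-composite is $\zeta\cup\xi\colon w\circ_i x\to z\circ_i y$. - The identity on a $j$-cell $x$ is $\emptyset\colon x\to x$. *)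

(* Defs.v *)
From mathcomp Require Import all_boot finmap boolp.

Set Implicit Arguments.
Unset Strict Implicit.
Unset Printing Implicit Defensive.

(** * Strict omega-categories *)

(* A globular set is presented by the disjoint union [cell] of its sets of
   k-cells, graded by [dim].  All operations are total: the values of [src] and
   [tgt] on 0-cells, and of [comp] outside [composable], are junk, about which
   neither the axioms nor the notion of functor say anything. *)
Record precat := Precat {
  cell :> Type;
  dim : cell -> nat;
  src : cell -> cell;
  tgt : cell -> cell;
  idc : cell -> cell;
  comp : nat -> cell -> cell -> cell  (* [comp n y x] is y o_n x *)
}.

Section Precat.
Variable X : precat.
Implicit Types (x y z : X) (n k : nat).

Definition srcn n x : X := iter (dim x - n) (@src X) x.
Definition tgtn n x : X := iter (dim x - n) (@tgt X) x.

Definition idto k x : X := iter (k - dim x) (@idc X) x.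

(* Composition of cells of possibly different dimensions. *)
Definition wcomp n y x : X :=
  let k := maxn (dim y) (dim x) in comp n (idto k y) (idto k x).

Definition composable n y x : Prop :=
  [/\ dim y = dim x, n < dim x & tgtn n x = srcn n y].

Record is_omega_cat : Prop := IsOmegaCat {
  dim_src : forall x, 0 < dim x -> dim (src x) = (dim x).-1;
  dim_tgt : forall x, 0 < dim x -> dim (tgt x) = (dim x).-1;
  src_src : forall x, 1 < dim x -> src (src x) = src (tgt x);
  tgt_src : forall x, 1 < dim x -> tgt (src x) = tgt (tgt x);
  dim_idc : forall x, dim (idc x) = (dim x).+1;
  src_idc : forall x, src (idc x) = x;
  tgt_idc : forall x, tgt (idc x) = x;
  dim_comp : forall n y x, composable n y x -> dim (comp n y x) = dim x;
  src_comp : forall n y x, composable n y x ->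
    src (comp n y x) =
      if n.+1 == dim x then src x else comp n (src y) (src x);
  tgt_comp : forall n y x, composable n y x ->
    tgt (comp n y x) =
      if n.+1 == dim x then tgt y else comp n (tgt y) (tgt x);
  compA : forall n z y x, composable n z y -> composable n y x ->
    comp n z (comp n y x) = comp n (comp n z y) x;
  comp_idl : forall n x, n < dim x -> comp n (idto (dim x) (tgtn n x)) x = x;
  comp_idr : forall n x, n < dim x -> comp n x (idto (dim x) (srcn n x)) = x;
  idc_comp : forall n y x, composable n y x ->
    idc (comp n y x) = comp n (idc y) (idc x);
  comp_interchange : forall n m y' y x' x, n < m ->
    composable m y' y -> composable m x' x -> composable n y x ->
    comp n (comp m y' y) (comp m x' x) = comp m (comp n y' x') (comp n y x)
}.

End Precat.

Record is_omega_functor (X Y : precat) (f : X -> Y) : Prop := IsOmegaFunctor {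
  functor_dim : forall x, dim (f x) = dim x;
  functor_src : forall x, 0 < dim x -> f (src x) = src (f x);
  functor_tgt : forall x, 0 < dim x -> f (tgt x) = tgt (f x);
  functor_idc : forall x, f (idc x) = idc (f x);
  functor_comp : forall n y x, composable n y x ->
    f (comp n y x) = comp n (f y) (f x)
}.

Definition isomorphic (X Y : precat) : Prop :=
  exists (f : X -> Y) (g : Y -> X),
    [/\ is_omega_functor f, is_omega_functor g, cancel f g & cancel g f].

Definition terminal : precat :=
  {| cell := nat; dim := id; src := predn; tgt := predn; idc := succn;
     comp := fun _ y _ => y |}.

(** * Cells presented as labelled globes *)

(* In both the lax coslice and the oriental, a cell consists of its source, its
   target and further data, so formal cells are labelled binary trees. *)
Inductive globe (A : Type) : Type :=
| Pt of A
| Arr of globe A & globe A & A.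

Section Globe.
Variable A : Type.
Implicit Types (c m p x y : globe A) (n : nat).

Definition label c : A := match c with Pt l => l | Arr _ _ l => l end.
Definition gsrc c := if c is Arr m _ _ then m else c.
Definition gtgt c := if c is Arr _ p _ then p else c.
Fixpoint gdim c : nat := if c is Arr m _ _ then (gdim m).+1 else 0.

Definition gsrcn n c := iter (gdim c - n) gsrc c.
Definition gtgtn n c := iter (gdim c - n) gtgt c.

Definition gparallel m p : Prop :=
  gdim m = gdim p /\ (0 < gdim m -> gsrc m = gsrc p /\ gtgt m = gtgt p).

(* [f n y x] is the label of y o_n x. *)
Fixpoint gcomp (f : nat -> globe A -> globe A -> A) n y x : globe A :=
  match y, x with
  | Arr my py _, Arr mx px _ =>
      if n == gdim mx then Arr mx py (f n y x)
      else Arr (gcomp f n my mx) (gcomp f n py px) (f n y x)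
  | _, _ => y
  end.

Variable P : globe A -> Prop.

Definition clamp (d : {c | P c}) (c : globe A) : {c | P c} :=
  if pselect (P c) is left Pc then exist P c Pc else d.

(* The globes satisfying [P].  An operation whose result fails [P] returns one
   of its arguments instead, which breaks the axioms on dimensions and
   boundaries unless it happens outside the domain of the operation: so
   [is_omega_cat] for the structure below includes closure of [P] under
   boundaries, identities and composites. *)
Definition globes (idl : A -> A) (f : nat -> globe A -> globe A -> A) : precat :=
  {| cell := {c | P c};
     dim := fun u => gdim (sval u);
     src := fun u => clamp u (gsrc (sval u));
     tgt := fun u => clamp u (gtgt (sval u));
     idc := fun u => clamp u (Arr (sval u) (sval u) (idl (label (sval u))));
     comp := fun n v u => clamp v (gcomp f n (sval v) (sval u)) |}.

End Globe.

(** * The lax coslice and the cone *)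

Section Coslice.
Variable X : precat.

(* The label of a cell is the pair of x and x-bar. *)
Local Notation cglobe := (globe (X * X)).
Implicit Types (c m p x y : cglobe) (a h z : X) (n : nat).

Definition base c : X := (label c).1.
Definition bar c : X := (label c).2.

(* With (m_i, p_i) the i-boundary of c, [whisker n c z] is
     ... p-bar_3 o_3 p-bar_1 o_1 z o_0 m-bar_0 o_2 m-bar_2 ...
   using the m-bar_i with i < n even and the p-bar_i with i < n odd. *)
Fixpoint whisker n c z : X :=
  if n is i.+1 then
    if odd i then wcomp i (bar (gtgtn i c)) (whisker i c z)
    else wcomp i (whisker i c z) (bar (gsrcn i c))
  else z.

Fixpoint coslice_cell a c : Prop :=
  match c with
  | Pt (x, b) =>
      [/\ dim a = 0, dim x = 0, dim b = 1, src b = a & tgt b = x]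
  | Arr m p (x, b) =>
      let n := gdim m in
      [/\ coslice_cell a m, coslice_cell a p & gparallel m p] /\
      [/\ dim x = n.+1, src x = base m & tgt x = base p] /\
      dim b = n.+2 /\
      if odd n then src b = bar m /\ tgt b = whisker n.+1 c x
      else src b = whisker n.+1 c x /\ tgt b = bar p
  end.

Definition coslice_label n y x : X * X :=
  (comp n (base y) (base x),
   if odd n then
     wcomp n.+1 (wcomp n (bar y) (whisker n x (tgtn n.+1 (base x)))) (bar x)
   else
     wcomp n.+1 (bar y) (wcomp n (whisker n x (srcn n.+1 (base y))) (bar x))).

Definition coslice a : precat :=
  globes (coslice_cell a) (fun l => (idc l.1, idc l.2)) coslice_label.

Fixpoint action c h : cglobe :=
  match c with
  | Pt (x, b) => Pt (x, comp 0 b h)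
  | Arr m p (x, b) =>
      Arr (action m (src h)) (action p (tgt h)) (x, comp 0 b h)
  end.

(* [Old x] is a cell of X; [Leg a c] is, for a 0-cell a of X (as enforced by
   [coslice_cell]), the cell c of the hom a/X from a to the apex, so of
   dimension one more than c; [Apex 0] is the new object, and [Apex k.+1] the
   k-cell of its terminal endo-hom. *)
Inductive cone_cell : Type :=
| Old of X
| Leg (a : X) of coslice a
| Apex of nat.

Definition cone_dim (u : cone_cell) : nat :=
  match u with
  | Old x => dim x
  | Leg _ c => (dim c).+1
  | Apex k => k
  end.

Definition cone_src (u : cone_cell) : cone_cell :=
  match u with
  | Old x => Old (src x)
  | Leg a c => if dim c == 0 then Old a else Leg (src c)
  | Apex k => Apex k.-1
  end.

Definition cone_tgt (u : cone_cell) : cone_cell :=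
  match u with
  | Old x => Old (tgt x)
  | Leg a c => if dim c == 0 then Apex 0 else Leg (tgt c)
  | Apex k => Apex k.-1
  end.

Definition cone_idc (u : cone_cell) : cone_cell :=
  match u with
  | Old x => Old (idc x)
  | Leg a c => Leg (idc c)
  | Apex k => Apex k.+1
  end.

Definition cone_comp n (v u : cone_cell) : cone_cell :=
  match v, u with
  | Old y, Old x => Old (comp n y x)
  | Apex k, Apex _ => Apex k
  | Leg b c, Old h =>
      if n is 0 then
        if pselect (coslice_cell (srcn 0 h) (action (sval c) h)) is left e
        then @Leg (srcn 0 h) (exist _ _ e) else v
      else v
  | Apex _, Leg a c => if n is 0 then u else v
  | Leg b d, Leg a c =>
      if n is m.+1 then
        if pselect (a = b) is left e
        then @Leg b (comp m d (eq_rect a coslice c b e)) else v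
      else v
  | _, _ => v
  end.

Definition cone : precat :=
  {| cell := cone_cell; dim := cone_dim; src := cone_src; tgt := cone_tgt;
     idc := cone_idc; comp := cone_comp |}.

End Coslice.

(** * Orientals *)

Local Open Scope fset_scope.

(* An order-preserving injection a : [j] -> [n] is the sequence of its values
   a(0) < ... < a(j); precomposing it with delta_k omits a(k). *)
Definition simplex (n j : nat) (a : seq nat) : bool :=
  [&& sorted ltn a, size a == j.+1 & all (fun i => i <= n) a].

Definition omit (k : nat) (a : seq nat) : seq nat := take k a ++ drop k.+1 a.

Definition plus (a : seq nat) : {fset seq nat} :=
  [fset omit k a | k in [seq k <- iota 0 (size a) | ~~ odd k]].
Definition minus (a : seq nat) : {fset seq nat} :=
  [fset omit k a | k in [seq k <- iota 0 (size a) | odd k]].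

Definition plusS (xi : {fset seq nat}) := \bigcup_(a <- xi) plus a.
Definition minusS (xi : {fset seq nat}) := \bigcup_(a <- xi) minus a.

Fixpoint oriental_cell (n : nat) (c : globe {fset seq nat}) : Prop :=
  match c with
  | Pt l => exists2 i, i <= n & l = [fset [:: i]]
  | Arr m p xi =>
      let j := gdim m in
      [/\ oriental_cell n m, oriental_cell n p & gparallel m p] /\
      (forall a, a \in xi -> simplex n j.+1 a) /\
      (forall a b, a \in xi -> b \in xi -> a <> b ->
         plus a `&` plus b = fset0 /\ minus a `&` minus b = fset0) /\
      label p = (label m `|` plusS xi) `\` minusS xi /\
      label m = (label p `|` minusS xi) `\` plusS xi
  end.

Definition oriental (n : nat) : precat :=
  globes (oriental_cell n) (fun _ => fset0) (fun _ y x => label y `|` label x).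

(* Main.v *)
From Pilot Require Import Defs.
From mathcomp Require Import all_boot finmap boolp zify.
(* The second import makes comp denote composition of cells again, rather than
   composition of functions. *)
Import Pilot.Defs.

Set Implicit Arguments.
Unset Strict Implicit.
Unset Printing Implicit Defensive.

(** Why the theorem holds.

Following Steiner, a k-cell of the oriental is recorded by a table of chains: at
each level j <= k the indicator functions of its j-source and of its j-target,
viewed as chains with natural coefficients on the j-simplices.  The conditions
on a table are linear: augmentation 1 at level 0, and

   source_j + (positive faces of c) = target_j + (negative faces of c)

for c either of the two chains of level j+1.  Composition adds chains above the
level of composition, so such tables are closed under all the operations, and
the axioms of a strict omega-category hold for them by inspection.  A [model] with
m vertices is a precat whose cells are exactly the tables over the
vertices 0, ..., m-1 and whose operations are those of tables; a model is an
omega-category ([model_omega_cat]) and any two models with the same m are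
isomorphic ([model_isomorphic]).  Hence it suffices that the terminal
omega-category is a model for m = 1, that the cone of a model for m is a model
for m+1 ([cone_model]), and that the n-th oriental is a model for n+1
([oriental_model]).

The last two facts come from splitting a table over 0, ..., m at its last vertex m.
Either m does not occur, or the table is the vertex m, or the table leads from
an old vertex to m ([steinerP]).  In the last case let x_j be the link of m
in the chain of level j+1, and N_j the part of the chain of level j that avoids
m.  Deleting m from a (j+1)-simplex is a positive face exactly when j is odd, so
the linear conditions say that the x_j form a table, one dimension lower, and
that N_j becomes a table once x_j is added to the source at odd levels and to
the target at even levels ([steiner_link], [steiner_bar], [steiner_leg]).  These
two tables are those of the two components of a cell of the lax coslice: in a
whiskering, a cell of lower dimension contributes only at its own top level, so
the iterated whiskering in the definition of the coslice adds just the terms N_j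
and x_j above ([whiskerE], [coslice_okP]).  Composition and the right action are
compared in the same way; closure of the coslice under them follows because the
composite table is realised by some cell of the coslice, which then has to be
the formal composite ([coslice_gcomp], [action_eq]).

For the oriental, tables have to be sets of simplices, and the disjointness
conditions on faces are not linear.  They hold for every table: by induction on
the number of vertices, each of them reduces to the same condition for the two
tables of the splitting ([steiner_le1]). *)

(** * Tables of chains *)

Definition chain := seq nat -> nat.
(** [T j b] is the chain at level j of the source (b = false) or of the target
(b = true). *)
Definition table := nat -> bool -> chain.

Definition is_simplex m (s : seq nat) := sorted ltn s && all (fun u => u < m) s.

Definition insert v (s : seq nat) : seq nat :=
  [seq u <- s | u < v] ++ v :: [seq u <- s | v < u].

(** The sum over the simplices having s as a face of sign b (false for positive),
written as a sum over the vertex v to insert, which makes sense for an arbitrary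
function f.  For b = false and s empty this is the augmentation. *)
Definition bdry m (b : bool) (f : chain) (s : seq nat) : nat :=
  \sum_(v < m | (nat_of_ord v \notin s) && (odd (count (fun u => u < v) s) == b))
     f (insert v s).

Lemma tableP (T T' : table) : (forall j b s, T j b s = T' j b s) -> T = T'.
Proof. by move=> e; apply: funext => j; apply: funext => b; apply: funext => s. Qed.

Lemma bdryD m b f g s :
  bdry m b (fun t => f t + g t) s = bdry m b f s + bdry m b g s.
Proof. by rewrite /bdry big_split. Qed.

Lemma eq_bdry m b f g s : (forall v, v < m -> f (insert v s) = g (insert v s)) ->
  bdry m b f s = bdry m b g s.
Proof. by move=> e; apply: eq_bigr => v _; apply: e. Qed.

Lemma bdry0 m b f s : (forall t, f t = 0) -> bdry m b f s = 0.
Proof. by move=> e; apply: big1. Qed.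

Lemma bdry_nil m f : bdry m true f [::] = 0.
Proof. by apply: big1. Qed.

Lemma bdry_nil_eq0 m f v : bdry m false f [::] = 0 -> v < m -> f [:: v] = 0.
Proof.
move=> /eqP; rewrite /bdry sum_nat_eq0 => /forallP h lt.
by have /= /eqP := h (Ordinal lt).
Qed.

(** The apex m comes last, so inserting it into s puts it in position [size s]. *)
Lemma bdry_nonapex m b f s : all (fun u => u < m) s ->
  bdry m.+1 b f s =
  bdry m b f s + (if odd (size s) == b then f (rcons s m) else 0).
Proof.
move=> /allP lt; rewrite /bdry big_mkcond big_ord_recr -big_mkcond /=; congr (_ + _).
have -> : m \notin s by apply/negP => /lt; rewrite ltnn.
have -> : count (fun u => u < m) s = size s by apply/eqP; rewrite -all_count; apply/allP.
rewrite /insert; have -> : [seq u <- s | u < m] = s by apply/all_filterP/allP.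
suff -> : [seq u <- s | m < u] = [::] by rewrite cats1.
apply/eqP; rewrite -[_ == _]negbK -has_filter; apply/negP => /hasP[u /lt]; lia.
Qed.

Lemma insert_rcons m v s : v < m -> insert v (rcons s m) = rcons (insert v s) m.
Proof.
by move=> lt; rewrite /insert !filter_rcons lt ltnNge (ltnW lt) /= rcons_cat.
Qed.

(** Inserting v < m neither moves m from the last position nor changes a sign, and
m itself cannot be inserted again. *)
Lemma bdry_apex m b f s :
  bdry m.+1 b f (rcons s m) = bdry m b (fun t => f (rcons t m)) s.
Proof.
rewrite /bdry big_mkcond big_ord_recr -big_mkcond /= mem_rcons mem_head addn0.
apply: eq_big => [v|v _] /=; last by rewrite insert_rcons.
rewrite mem_rcons in_cons (ltn_eqF (ltn_ord v)) -cats1 count_cat /=.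
by rewrite (ltnNge m) (ltnW (ltn_ord v)) !addn0.
Qed.

Lemma size_insert v s : v \notin s -> size (insert v s) = (size s).+1.
Proof.
move=> nv; rewrite /insert size_cat /= !size_filter addnS; congr _.+1.
rewrite -(count_predC (fun u => u < v)); congr (_ + _).
apply: eq_in_count => u us /=; case: (ltngtP u v) => // e.
by rewrite -e us in nv.
Qed.

Lemma is_simplex_rcons m s : is_simplex m.+1 (rcons s m) = is_simplex m s.
Proof.
rewrite /is_simplex all_rcons leqnn /= !(sorted_pairwise ltn_trans) pairwise_rcons.
rewrite -andbA andbCA; congr (_ && _); apply/andP/idP => [[] //|h].
by split=> //; apply: sub_all h => u; rewrite ltnS => /ltnW.
Qed.

Lemma is_simplexW m s : is_simplex m s -> is_simplex m.+1 s.
Proof.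
by case/andP=> srt h; rewrite /is_simplex srt; apply: sub_all h => u /ltnW; rewrite ltnS.
Qed.

Variant is_simplex_spec m s : Prop :=
| SimplexOld of is_simplex m s & m \notin s
| SimplexApex t of is_simplex m t & s = rcons t m.

Lemma is_simplexP m s : is_simplex m.+1 s -> is_simplex_spec m s.
Proof.
case: (lastP s) => [|t v]; first by move=> _; apply: SimplexOld.
move=> /[dup] h /andP[]; rewrite all_rcons.
rewrite (sorted_pairwise ltn_trans) pairwise_rcons => /andP[lt srt] /andP[+ _].
rewrite ltnS leq_eqVlt => /orP[/eqP e|ltv].
  by subst v; apply: (@SimplexApex _ _ t) => //; rewrite -is_simplex_rcons.
have al : all (fun u => u < m) (rcons t v).
  by rewrite all_rcons ltv; apply: sub_all lt => u /ltn_trans; apply.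
apply: SimplexOld; first by rewrite /is_simplex al andbT; case/andP: h.
by apply/negP => /(allP al); rewrite ltnn.
Qed.

Lemma apex_notin m s : is_simplex m s -> m \notin s.
Proof. by case/andP=> _ /allP h; apply/negP => /h; rewrite ltnn. Qed.

(** Levels above k are filled with zero chains instead of being absent: an identity
then has the table of the cell it is the identity of, and cells of different
dimensions can be composed without inserting identities. *)
Record steiner (m k : nat) (T : table) : Prop := Steiner {
  steiner_supp : forall j b s, T j b s <> 0 -> is_simplex m s /\ size s = j.+1;
  steiner_top : forall s, T k false s = T k true s;
  steiner_hi : forall j b s, k < j -> T j b s = 0;
  steiner_aug : forall b, bdry m false (T 0 b) [::] = 1;
  steiner_bdry : forall j b s, is_simplex m s ->
    T j false s + bdry m false (T j.+1 b) s =
    T j true s + bdry m true (T j.+1 b) s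
}.

(** The table of the k-source or of the k-target. *)
Definition trunc (T : table) k b : table := fun j c s =>
  if j < k then T j c s else if j == k then T k b s else 0.

(** The table of the composite of S after R along level n. *)
Definition tcomp n (S R : table) : table := fun j b s =>
  if j < n then R j b s
  else if j == n then (if b then S n true s else R n false s)
  else S j b s + R j b s.

Definition tcompat n (S R : table) : Prop :=
  (forall j b s, j < n -> R j b s = S j b s) /\
  (forall s, R n true s = S n false s).

Lemma trunc_id m k T b : steiner m k T -> trunc T k b = T.
Proof.
case=> _ top hi _ _; apply: tableP => j c s; rewrite /trunc.
case: (ltngtP j k) => [//|lt|->]; first by rewrite hi.
by case: b; case: c; rewrite ?top.
Qed.

Lemma trunc_trunc T k j b c : j < k -> trunc (trunc T k b) j c = trunc T j c.
Proof.
move=> lt; apply: tableP => i d s; rewrite /trunc lt.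
by case: (ltngtP i j) => // h; rewrite (ltn_trans h lt).
Qed.

Lemma truncE_lt T k b j c s : j < k -> trunc T k b j c s = T j c s.
Proof. by rewrite /trunc => ->. Qed.

Lemma truncE_eq T k b c s : trunc T k b k c s = T k b s.
Proof. by rewrite /trunc ltnn eqxx. Qed.

Lemma trunc_tcomp_src n S R : trunc (tcomp n S R) n false = trunc R n false.
Proof.
apply: tableP => j b s; rewrite /trunc /tcomp.
by case: (ltngtP j n); rewrite ?ltnn ?eqxx.
Qed.

Lemma trunc_tcomp_tgt n S R : tcompat n S R ->
  trunc (tcomp n S R) n true = trunc S n true.
Proof.
move=> [lo _]; apply: tableP => j b s; rewrite /trunc /tcomp.
by case: (ltngtP j n); rewrite ?ltnn ?eqxx // => /lo ->.
Qed.

Lemma trunc_tcomp n S R k b : n < k ->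
  trunc (tcomp n S R) k b = tcomp n (trunc S k b) (trunc R k b).
Proof.
move=> lt; apply: tableP => j c s; rewrite /trunc /tcomp.
case: (ltngtP j k) => [ltj|ltj|->]; first by rewrite lt.
  by rewrite ltnNge (ltnW (ltn_trans lt ltj)) /= gtn_eqF // (ltn_trans lt).
by rewrite ltnNge (ltnW lt) /= gtn_eqF.
Qed.

Lemma tcompat_trunc n S R k b : n < k -> tcompat n S R -> tcompat n (trunc S k b) (trunc R k b).
Proof.
move=> lt [lo mid]; split=> [j c s ltj|s]; last by rewrite !truncE_lt.
by rewrite !truncE_lt ?lo // (ltn_trans ltj lt).
Qed.

Lemma steiner_trunc m k T k' b : steiner m k T -> steiner m k' (trunc T k' b).
Proof.
case=> supp top hi aug bd; split.
- move=> j c s; rewrite /trunc; case: ifP => _; first exact: supp.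
  by case: eqP => // ->; apply: supp.
- by move=> s; rewrite /trunc ltnn eqxx.
- by move=> j c s lt; rewrite /trunc ltnNge ltnW //= gtn_eqF.
- by case: k' => [|k'] c; rewrite /trunc /=; apply: aug.
- move=> j c s gs; rewrite /trunc.
  case: (ltngtP j.+1 k') => [lt|lt|e].
  + exact: bd.
  + rewrite !bdry0 //; case: (ltngtP j k') => //; lia.
  + by subst k'; apply: bd.
Qed.

(** At level n the equation for the composite is the sum of those for R and S, in
which the common chain [R n true = S n false] cancels; the other levels are linear. *)
Lemma steiner_tcomp m k n S R : n < k -> tcompat n S R ->
  steiner m k S -> steiner m k R -> steiner m k (tcomp n S R).
Proof.
move=> ltk [lo mid] [sS tS hS aS bS] [sR tR hR aR bR]; split.
- move=> j b s; rewrite /tcomp; case: ifP => _; first exact: sR.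
  case: eqP => [->|_]; first by case: b; [apply: sS|apply: sR].
  case: (S j b s =P 0) => [-> | /sS //]; exact: sR.
- by move=> s; rewrite /tcomp ltnNge (ltnW ltk) /= gtn_eqF // tS tR.
- move=> j b s lt; rewrite /tcomp (ltnNge j) (ltnW (ltn_trans ltk lt)) /=.
  by rewrite gtn_eqF ?(ltn_trans ltk lt)// hS // hR.
- move=> b; rewrite /tcomp; case: n ltk lo mid => [|n] ltk lo mid /=; last exact: aR.
  by case: b => /=; [apply: aS|apply: aR].
- move=> j b s gs; rewrite /tcomp.
  case: (ltngtP j.+1 n) => [lt|lt|e].
  + exact: bR.
  + rewrite !bdryD; move: (bS j b s gs) (bR j b s gs).
    case: (ltngtP j n) => [||e]; [lia|lia|subst n].
    by move: (mid s) => /=; lia.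
  + subst n; case: b; last exact: bR.
    by rewrite !lo //; apply: bS.
Qed.

Lemma steiner_idc m k T : steiner m k T -> steiner m k.+1 T.
Proof.
case=> supp top hi aug bd; split=> // [s|j b s lt]; last by apply: hi; apply: ltnW.
by rewrite !hi.
Qed.

(** A directed cycle with nonnegative coefficients is zero.  Its link at the last
vertex is again a cycle, hence zero except possibly at the empty simplex, where
the augmentation kills it; so the last vertex does not occur, and the number of
vertices decreases. *)
Lemma acyclic m (f : chain) :
  (forall s, is_simplex m s -> bdry m false f s = bdry m true f s) ->
  forall s, is_simplex m s -> s != [::] -> f s = 0.
Proof.
elim: m f => [|m IH] f eqf s gs nz; first by case: s nz gs => // u s _ /andP[].
have apex t : is_simplex m t -> f (rcons t m) = 0.
  move=> gt; case: (altP (t =P [::])) => [->|tn].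
    have := eqf [::] isT; rewrite bdry_nil (@bdry_nonapex m false f [::]) //=; lia.
  apply: (IH (fun t => f (rcons t m))) => // r gr.
  by rewrite -!bdry_apex; apply: eqf; rewrite is_simplex_rcons.
case: (is_simplexP gs) => [gms _|t gt ->]; last exact: apex.
apply: IH => // t gt; have := eqf t (is_simplexW gt).
by rewrite !bdry_nonapex; try (by case/andP: gt); rewrite apex // !if_same !addn0.
Qed.

Lemma vanish m (T : table) :
  (forall j b s, T j b s <> 0 -> is_simplex m s /\ size s = j.+1) ->
  (forall b, bdry m false (T 0 b) [::] = 0) ->
  (forall j b s, is_simplex m s -> T j false s + bdry m false (T j.+1 b) s =
    T j true s + bdry m true (T j.+1 b) s) ->
  forall j b s, T j b s = 0.
Proof.
move=> supp aug bd; elim=> [|j IH] b s.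
  case: (T 0 b s =P 0) => // /[dup] nz /supp[/andP[_ al]].
  case: s al nz => [|u [|]] //= /andP[lt _] nz _.
  by case: nz; apply: bdry_nil_eq0 lt.
case: (T j.+1 b s =P 0) => // /[dup] nz /supp[gs sz].
apply: (acyclic (m := m)) => // [t gt|]; last by case: s sz {nz gs}.
by have := bd j b t gt; rewrite !IH.
Qed.

(** * Splitting a table at its last vertex *)

Section Apex.
Variables (m : nat) (T : table).

(** Removing the vertex m lowers the dimension by one, hence the shift of levels. *)
Definition link : table := fun j b s => T j.+1 b (rcons s m).
Definition off_apex : table := fun j b s => if m \in s then 0 else T j b s.
(** The table of the second component of a cell of the coslice whose first component
has table Z, N being the table of the part avoiding the apex.  The term Z enters
the sources of odd level and the targets of even level, the places where the
coslice whiskers by a cell of lower dimension. *)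
Definition bar_of (N Z : table) : table := fun j b s =>
  N j b s + (if b == ~~ odd j then Z j b s else 0).
Definition bar_table : table := bar_of off_apex link.

Hypothesis suppT : forall j b s, T j b s <> 0 -> is_simplex m.+1 s /\ size s = j.+1.

Lemma link_supp j b s : link j b s <> 0 -> is_simplex m s /\ size s = j.+1.
Proof. by move=> /suppT[]; rewrite is_simplex_rcons size_rcons => ? [->]. Qed.

Lemma off_apex_supp j b s : off_apex j b s <> 0 -> is_simplex m s /\ size s = j.+1.
Proof.
rewrite /off_apex; case: ifP => // ns /suppT[/is_simplexP[//|t _ e]].
by rewrite e mem_rcons mem_head in ns.
Qed.

Lemma insert_notin v s : is_simplex m s -> v < m -> m \notin insert v s.
Proof.
move=> /apex_notin ns lt; rewrite /insert mem_cat in_cons !mem_filter.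
by rewrite (negbTE ns) !andbF gtn_eqF.
Qed.

Lemma off_apex_bdry j b c s : is_simplex m s ->
  bdry m c (T j b) s = bdry m c (off_apex j b) s.
Proof.
by move=> gs; apply: eq_bdry => v lt; rewrite /off_apex (negbTE (insert_notin gs lt)).
Qed.

(** A simplex s of dimension j is a face of [rcons s m], positive exactly when j is odd. *)
Lemma bdry_old j b c s : is_simplex m s ->
  bdry m.+1 c (T j.+1 b) s =
  bdry m c (off_apex j.+1 b) s + (if c == ~~ odd j then link j b s else 0).
Proof.
move=> gs; rewrite bdry_nonapex; last by case/andP: gs.
rewrite off_apex_bdry // /link; congr (_ + _).
case: (T j.+1 b (rcons s m) =P 0) => [->|/suppT[_]]; first by rewrite !if_same.
by rewrite size_rcons => -[->]; rewrite eq_sym.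
Qed.

Lemma bdry_top j b c s : bdry m.+1 c (T j.+1 b) (rcons s m) = bdry m c (link j b) s.
Proof. exact: bdry_apex. Qed.

Lemma bdry_bar j b c s :
  bdry m c (bar_table j b) s = bdry m c (off_apex j b) s +
    (if b == ~~ odd j then bdry m c (link j b) s else 0).
Proof.
rewrite /bar_table /bar_of bdryD; case: ifP => // _; congr (_ + _); exact: bdry0.
Qed.

End Apex.

(** The table leads from a vertex other than m to the vertex m. *)
Definition is_leg m (T : table) := T 0 false [:: m] = 0 /\ T 0 true [:: m] = 1.

Lemma steiner_link m k T : is_leg m T -> steiner m.+1 k.+1 T ->
  steiner m k (link m T).
Proof.
move=> [l0 l1] [supp top hi aug bd]; split.
- exact: link_supp.
- by move=> s; apply: top.
- by move=> j b s lt; apply: hi.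
- move=> b; have := bd 0 b [:: m]; rewrite -[[:: m]]/(rcons [::] m).
  rewrite is_simplex_rcons => /(_ isT); rewrite !bdry_top bdry_nil /= l0 l1; lia.
- move=> j b s gs; have := bd j.+1 b (rcons s m); rewrite is_simplex_rcons => /(_ gs).
  by rewrite !bdry_top.
Qed.

Lemma off_apex_st_bdry m T j b s : (forall j b s, T j b s <> 0 ->
  is_simplex m.+1 s /\ size s = j.+1) ->
  is_simplex m s ->
  (T j false s + bdry m.+1 false (T j.+1 b) s =
   T j true s + bdry m.+1 true (T j.+1 b) s) =
  (off_apex m T j false s + bdry m false (off_apex m T j.+1 b) s +
    (if odd j then link m T j b s else 0) =
   off_apex m T j true s + bdry m true (off_apex m T j.+1 b) s +
     (if odd j then 0 else link m T j b s)).
Proof.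
move=> supp gs; rewrite !bdry_old // /off_apex (negbTE (apex_notin gs)) !addnA.
by case: (odd j).
Qed.

(** The equations for [bar_table m T] at s are those for T at s, to which the equations
for the link are added when the chain of level j+1 has a link term. *)
Lemma steiner_bar m k T : is_leg m T -> steiner m.+1 k.+1 T ->
  steiner m k.+1 (bar_table m T).
Proof.
move=> leg sT; have := steiner_link leg sT.
move: leg sT => [l0 l1] [supp top hi aug bd] [_ _ _ aug' bd']; split.
- move=> j b s; rewrite /bar_table /bar_of.
  case: (off_apex m T j b s =P 0) => [->|/off_apex_supp-/(_ supp) //].
  by case: ifP => // _; apply: link_supp.
- by move=> s; rewrite /bar_table /bar_of /off_apex /link top !(hi k.+2) // !if_same.
- move=> j b s lt; rewrite /bar_table /bar_of /off_apex /link !hi ?if_same //.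
  exact: ltnW.
- move=> b; rewrite bdry_bar /= -off_apex_bdry //.
  have := aug b; rewrite bdry_nonapex //=.
  by case: b; rewrite ?aug' ?l0 ?l1 //=; lia.
- move=> j b s gs; rewrite !bdry_bar /bar_table /bar_of /=.
  have := bd j b s (is_simplexW gs); rewrite off_apex_st_bdry //.
  have := bd' j b s gs.
  by case: b; case: (odd j) => /=; lia.
Qed.

(** The linear combinations in the proof of [steiner_bar] can be solved for the
equations of T. *)
Lemma steiner_leg m k T :
  (forall j b s, T j b s <> 0 -> is_simplex m.+1 s /\ size s = j.+1) ->
  is_leg m T -> (forall v, v < m -> T 0 true [:: v] = 0) ->
  (forall s, T k.+1 false s = T k.+1 true s) ->
  (forall j b s, k.+1 < j -> T j b s = 0) ->
  steiner m k (link m T) -> steiner m k.+1 (bar_table m T) -> steiner m.+1 k.+1 T.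
Proof.
move=> supp [l0 l1] l2 top hi [_ _ _ aug bd] [_ _ _ aug' bd']; split=> //.
  move=> b; rewrite bdry_nonapex //=; have := aug' b; rewrite bdry_bar -off_apex_bdry //=.
  case: b => /=; last by rewrite l0.
  move=> _; rewrite l1; suff -> : bdry m false (T 0 true) [::] = 0 by [].
  by apply: big1 => v _; apply: l2.
move=> j b s /is_simplexP[gs _|t gt ->].
  rewrite off_apex_st_bdry //; have := bd' j b s gs; have := bd j b s gs.
  rewrite !bdry_bar /bar_table /bar_of /=.
  by case: b; case: (odd j) => /=; lia.
rewrite !bdry_top; case: j => [|j]; last exact: bd.
case: (t =P [::]) => [->|].
  by rewrite bdry_nil aug l0 l1.
move=> /eqP nt; have z c : T 0 c (rcons t m) = 0.
  case: (T 0 c (rcons t m) =P 0) => // /supp[_]; rewrite size_rcons => -[e].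
  by rewrite -size_eq0 e in nt.
have z2 c : bdry m c (link m T 0 b) t = 0.
  apply: big1 => v /andP[nv _]; case: (link m T 0 b (insert v t) =P 0) => // /supp[_].
  rewrite size_rcons size_insert // => -[e].
  by rewrite -size_eq0 e in nt.
by rewrite !z !z2.
Qed.

(** The identities of the vertex m, in every dimension. *)
Definition apex_table m : table := fun j _ s => (j == 0) && (s == [:: m]).

Lemma steinerW m k T : steiner m k T -> steiner m.+1 k T.
Proof.
case=> supp top hi aug bd.
have T0 j b s : T j b (rcons s m) = 0.
  case: (T j b (rcons s m) =P 0) => // /supp[/apex_notin]; by rewrite mem_rcons mem_head.
split=> //.
- by move=> j b s /supp[/is_simplexW].
- by move=> b; rewrite bdry_nonapex //= -[[:: m]]/(rcons [::] m) T0 addn0.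
- move=> j b s /is_simplexP[gs _|t gt ->].
    rewrite !bdry_nonapex ?T0 ?if_same ?addn0; try by case/andP: gs.
    exact: bd.
  by rewrite !bdry_apex !T0 !bdry0.
Qed.

Lemma steiner_apex m k : steiner m.+1 k (apex_table m).
Proof.
split.
- move=> j b s; rewrite /apex_table; case: eqP => // ->; case: eqP => // -> _.
  by rewrite /is_simplex /= ltnSn.
- by [].
- by case.
- move=> b; rewrite bdry_nonapex //=.
  have -> : apex_table m 0 b [:: m] = 1 by rewrite /apex_table !eqxx.
  rewrite [bdry _ _ _ _]big1 // => v _.
  by rewrite /apex_table /= /insert /= eqseq_cons ltn_eqF.
- by move=> j b s gs; rewrite !bdry0.
Qed.

Variant steiner_spec m k T : Prop :=
| SteinerOld of steiner m k T
| SteinerLeg k' of k = k'.+1 & is_leg m T & (forall v, v < m -> T 0 true [:: v] = 0)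
| SteinerApex of T = apex_table m.

(** The coefficients at m of the 0-source and of the 0-target are 0 or 1 by the
augmentation, and their difference is the augmentation of the link.  The case of
a table leading from m elsewhere is thus impossible; if they agree, the link
vanishes by acyclicity, and if moreover both are 1 so does everything else. *)
Lemma steinerP m k T : steiner m.+1 k T -> steiner_spec m k T.
Proof.
case=> supp top hi aug bd.
have augE b : bdry m false (T 0 b) [::] + T 0 b [:: m] = 1.
  by rewrite -(aug b) bdry_nonapex.
have bdA j b t : is_simplex m t ->
    T j false (rcons t m) + bdry m false (link m T j b) t =
    T j true (rcons t m) + bdry m true (link m T j b) t.
  by move=> gt; rewrite -!bdry_apex; apply: bd; rewrite is_simplex_rcons.
have leg b : T 0 false [:: m] + bdry m false (link m T 0 b) [::] = T 0 true [:: m].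
  by rewrite (bdA 0 b [::]) // bdry_nil addn0.
case: (T 0 false [:: m] =P T 0 true [:: m]) => [e|ne]; last first.
  have l1 : T 0 true [:: m] = 1 by move: (leg false) (augE true); lia.
  have l0 : T 0 false [:: m] = 0 by move: (augE false); lia.
  case: k top hi => [|k'] top hi; first by rewrite top in ne.
  apply: (SteinerLeg (k' := k')) => // v lt.
  by apply: (@bdry_nil_eq0 m) lt; move: (augE true); lia.
have apex0 : forall j b s, link m T j b s = 0.
  apply: (vanish (m := m)) => [||j b s]; first exact: link_supp.
    by move=> b; move: (leg b); lia.
  exact: (bdA j.+1).
have [z|nz] : T 0 true [:: m] = 0 \/ T 0 true [:: m] = 1 by move: (augE true); lia.
  apply: SteinerOld; have old j b s : T j b s <> 0 -> is_simplex m s.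
    move=> /[dup] nz /supp[/is_simplexP[//|t gt e'] sz]; case: nz; rewrite e'.
    case: j sz => [|j] sz; last exact: apex0.
    by case: t gt e' sz => [|u t] _ ->; rewrite size_rcons // => _; case: b; rewrite /= ?e z.
  split=> //.
  - by move=> j b s /[dup] /old gs /supp[].
  - by move=> b; move: (augE b); case: b; rewrite ?e z addn0.
  - move=> j b s gs; have := bd j b s (is_simplexW gs); rewrite !bdry_nonapex;
    try by case/andP: gs.
    by have := apex0 j b s; rewrite /link => ->; rewrite !if_same !addn0.
have rest0 : forall j b s, off_apex m T j b s = 0.
  apply: (vanish (m := m)) => [||j b s gs]; first exact: off_apex_supp.
    move=> b; rewrite -off_apex_bdry //; move: (augE b).
    by case: b; rewrite ?e nz; lia.
  have := bd j b s (is_simplexW gs); rewrite off_apex_st_bdry // apex0.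
  by rewrite !if_same !addn0.
apply: SteinerApex; apply: tableP => j b s; rewrite /apex_table.
case: (T j b s =P 0) => [z|/[dup] nz' /supp[/is_simplexP[gs ns|t gt e'] sz]]; last first.
- rewrite e' in sz nz' *; case: j sz nz' => [|j] sz nz'; last by case: nz'; apply: apex0.
  case: t {gt e'} sz nz' => [|u t]; rewrite size_rcons // => _ _.
  by rewrite !eqxx; case: b; rewrite /= ?e nz.
- by case: nz'; rewrite -(rest0 j b s) /off_apex (negbTE ns).
rewrite z; case: eqP => //= j0; case: eqP => //= s0; move: z.
by rewrite j0 s0; case: b; rewrite ?e nz.
Qed.

(** The one inequality that yields all the disjointness needed for the oriental: the
chains are sets, distinct simplices of a chain share no face of the same sign,
and the source is disjoint from the positive faces of what lies above it.  At a
simplex containing the apex it is the inequality for the link, at any other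
simplex it is, up to the equations, the one for [bar_table m T]. *)
Lemma steiner_le1 m k T : steiner m k T -> forall j b s, is_simplex m s ->
  T j false s + bdry m false (T j.+1 b) s <= 1.
Proof.
elim: m k T => [|m IH] k T sT j b s.
  by have := steiner_aug sT false; rewrite /bdry big_ord0.
case: (steinerP sT) => [sT' gs|k' ek leg _ gs|->].
- have old j' b' t : m \in t -> T j' b' t = 0.
    by move=> mt; case: (T j' b' t =P 0) => // /(steiner_supp sT')[/apex_notin]; rewrite mt.
  case: (is_simplexP gs) => [gs' ns|t gt ->].
    rewrite bdry_nonapex; last by case/andP: gs'.
    by rewrite (old _ _ (rcons s m)) ?mem_rcons ?mem_head // if_same addn0;
      apply: IH sT' _ _ _ _.
  rewrite old ?mem_rcons ?mem_head // bdry_apex bdry0 // => r.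
  by rewrite old // mem_rcons mem_head.
- subst k; have sX := steiner_link leg sT; have sB := steiner_bar leg sT.
  have supp := steiner_supp sT.
  case: (is_simplexP gs) => [gs' ns|t gt ->].
    have := IH _ _ sB j b s gs'; have := steiner_bdry sB j b gs'.
    have := steiner_bdry sX j b gs'.
    have := steiner_bdry sT j b gs; rewrite off_apex_st_bdry // bdry_old // !bdry_bar.
    rewrite /bar_table /bar_of /off_apex (negbTE ns) /=.
    by case: b; case: (odd j) => /=; lia.
  rewrite bdry_top; case: j => [|j]; last by apply: IH sX _ _ _ _.
  case: t gt => [|u t] gt.
    by rewrite (steiner_aug sX) /= leg.1.
  case: (T 0 false (rcons (u :: t) m) =P 0) => [->|/supp[_]]; last by rewrite size_rcons.
  rewrite [bdry _ _ _ _]big1 // => v /andP[nv _];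
    case: (link m T 0 b (insert v (u :: t)) =P 0) => // /supp[_].
  by rewrite size_rcons size_insert.
- move=> gs; rewrite bdry0 // addn0 /apex_table.
  by case: (_ && _).
Qed.

(** * Omega-categories presented by tables *)

(** Source and target are treated uniformly, the sign being a boolean. *)
Definition bd (X : precat) (b : bool) (x : X) : X := if b then tgt x else src x.
Definition bdn (X : precat) j (b : bool) (x : X) : X :=
  if b then tgtn j x else srcn j x.

Definition bd_spec (X : precat) (tb : X -> table) : Prop := forall b (x : X), 0 < dim x ->
  dim (bd b x) = (dim x).-1 /\ tb (bd b x) = trunc (tb x) (dim x).-1 b.

(** Kept apart from [model] because composability has to be read off the tables
([composableE]) before anything about composites can be proved. *)
Record tabulated (m : nat) (X : precat) (tb : X -> table) : Prop := Tabulated {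
  tb_valid : forall x, steiner m (dim x) (tb x);
  tb_inj : forall x y, dim x = dim y -> tb x = tb y -> x = y;
  tb_bd : bd_spec tb
}.

Record model (m : nat) (X : precat) (tb : X -> table) : Prop := Model {
  md_tab :> tabulated m tb;
  md_surj : forall k T, steiner m k T -> exists x : X, dim x = k /\ tb x = T;
  md_idc : forall x : X, dim (idc x) = (dim x).+1 /\ tb (idc x) = tb x;
  md_comp : forall n (y x : X), composable n y x ->
    dim (comp n y x) = dim x /\ tb (comp n y x) = tcomp n (tb y) (tb x)
}.

Section Tabulated.
Variables (m : nat) (X : precat) (tb : X -> table).
Hypothesis tX : tabulated m tb.
Implicit Types x y z : X.

Lemma bdnE j b x : j <= dim x ->
  dim (bdn j b x) = j /\ tb (bdn j b x) = trunc (tb x) j b.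
Proof.
have e y i : bdn i b y = iter (dim y - i) (@bd X b) y by rewrite /bdn; case: b.
rewrite e; move h: (dim x - j) => d; elim: d => [|d IH] in j h *.
  move=> le; have -> : j = dim x by lia.
  by rewrite /= (trunc_id _ (tb_valid tX x)).
move=> le; have /= [||] := IH j.+1; try lia.
move=> ed et; have [|ed' et'] := tb_bd tX b (x := iter d (bd b) x); first by rewrite ed.
by rewrite ed' et' ed et /= trunc_trunc.
Qed.

Lemma dim_bdn j b x : j <= dim x -> dim (bdn j b x) = j.
Proof. by case/(bdnE b). Qed.

Lemma tb_bdn j b x : j <= dim x -> tb (bdn j b x) = trunc (tb x) j b.
Proof. by case/(bdnE b). Qed.

Lemma composableE n y x : composable n y x <->
  [/\ dim y = dim x, n < dim x & tcompat n (tb y) (tb x)].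
Proof.
split=> -[e lt h]; split=> //.
  have : trunc (tb x) n true = trunc (tb y) n false.
    rewrite -!tb_bdn ?e ?(ltnW lt) //; congr tb; exact: h.
  move=> et; split=> [j b s ltj|s].
    by have := congr1 (fun T : table => T j b s) et; rewrite !truncE_lt.
  by have := congr1 (fun T : table => T n true s) et; rewrite !truncE_eq.
have -> : tgtn n x = bdn n true x by [].
have -> : srcn n y = bdn n false y by [].
apply: (tb_inj tX); first by rewrite !dim_bdn ?e ?(ltnW lt).
rewrite !tb_bdn ?e ?(ltnW lt) //; case: h => lo mid.
apply: tableP => j b s; rewrite /trunc; case: ltngtP => // h; exact: lo.
Qed.

End Tabulated.

Section Model.
Variables (m : nat) (X : precat) (tb : X -> table).
Hypothesis mX : model m tb.
Implicit Types x y z : X.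

Lemma dim_idto k x : dim (idto k x) = maxn k (dim x).
Proof.
rewrite /idto; have -> : maxn k (dim x) = (k - dim x) + dim x by lia.
by elim: (k - _) => //= d IH; rewrite (md_idc mX _).1 IH.
Qed.

Lemma tb_idto k x : tb (idto k x) = tb x.
Proof. by rewrite /idto; elim: (k - _) => //= d IH; rewrite (md_idc mX _).2. Qed.

(** Iterated identities are invisible in tables, so the padding disappears. *)
Lemma wcompE n y x : n < maxn (dim y) (dim x) -> tcompat n (tb y) (tb x) ->
  dim (wcomp n y x) = maxn (dim y) (dim x) /\
  tb (wcomp n y x) = tcomp n (tb y) (tb x).
Proof.
move=> lt h; rewrite /wcomp; have [|-> ->] := md_comp mX (n := n)
    (y := idto (maxn (dim y) (dim x)) y) (x := idto (maxn (dim y) (dim x)) x).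
  by apply/(composableE mX); rewrite !dim_idto !tb_idto; split=> //; lia.
by rewrite !tb_idto dim_idto; split=> //; lia.
Qed.

Lemma model_ext x y : dim x = dim y ->
  (forall j b s, tb x j b s = tb y j b s) -> x = y.
Proof. by move=> e h; apply: (tb_inj mX) => //; apply: tableP. Qed.

Lemma tb_top x b c s : tb x (dim x) b s = tb x (dim x) c s.
Proof. by have := steiner_top (tb_valid mX x) s; case: b; case: c. Qed.

Lemma tb_hi x j b s : dim x < j -> tb x j b s = 0.
Proof. by move=> lt; apply: (steiner_hi (tb_valid mX x)). Qed.

Lemma dim0_ext x y : dim x = 0 -> dim y = 0 ->
  (forall s, tb x 0 true s = tb y 0 true s) -> x = y.
Proof.
move=> dx dy h; apply: model_ext; first by rewrite dx dy.
move=> [|j] f s; last by rewrite !tb_hi ?dx ?dy.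
have := tb_top x f true s; have := tb_top y f true s.
by rewrite dx dy => -> ->.
Qed.

Lemma bdE b x : 0 < dim x ->
  dim (bd b x) = (dim x).-1 /\ tb (bd b x) = trunc (tb x) (dim x).-1 b.
Proof. exact: tb_bd mX b x. Qed.

Lemma model_bd_bd b c x : 1 < dim x -> bd b (bd c x) = bd b (bd (~~ c) x).
Proof.
move=> lt; have [d1 t1] := bdE c (ltnW lt); have [d2 t2] := bdE (~~ c) (ltnW lt).
have [|d3 t3] := bdE b (x := bd c x); first by rewrite d1; lia.
have [|d4 t4] := bdE b (x := bd (~~ c) x); first by rewrite d2; lia.
apply: model_ext; first by rewrite d3 d4 d1 d2.
by move=> j d s; rewrite t3 t4 t1 t2 d1 d2 !trunc_trunc //; lia.
Qed.

Lemma model_bd_comp b n y x : composable n y x ->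
  bd b (comp n y x) =
    if n.+1 == dim x then bd b (if b then y else x) else comp n (bd b y) (bd b x).
Proof.
move=> h; have [d1 t1] := md_comp mX h.
have [e lt [lo mid]] := (composableE mX n y x).1 h.
have [|d2 t2] := bdE b (x := comp n y x); first by lia.
have [|dx tx] := bdE b (x := x); first by lia.
have [|dy ty] := bdE b (x := y); first by lia.
case: eqP => [ne|ne].
  have [|d3 t3] := bdE b (x := if b then y else x); first by case: b {d2 t2 dx tx dy ty}; lia.
  have ed : dim (if b then y else x) = dim x by case: b {d2 t2 dx tx dy ty d3 t3}.
  apply: model_ext; first by rewrite d2 d3 ed d1.
  move=> j c s; rewrite t2 t3 ed d1 t1 -ne /= /trunc /tcomp ltnn eqxx.
  by case: (ltngtP j n) => // ltj; case: b {d2 t2 dx tx dy ty d3 t3 ed} => //; apply: lo.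
have ltn : n < (dim x).-1 by lia.
have hc : composable n (bd b y) (bd b x).
  apply/(composableE mX); rewrite dx dy tx ty e; split=> //; split=> [j c s ltj|s].
    by rewrite !truncE_lt ?lo //; lia.
  by rewrite !truncE_lt ?mid //; lia.
have [d3 t3] := md_comp mX hc.
apply: model_ext; first by rewrite d3 d2 d1 dx.
move=> j c s; rewrite t3 t2 tx ty t1 d1 e /trunc /tcomp.
move: ltn; move: (dim x).-1 => k ltn.
case: (ltngtP j n) => [ltj|ltj|->]; rewrite ?ltn //.
- by rewrite (ltn_trans ltj ltn).
- by case: (ltngtP j k) => // _; case: (ltngtP k n) ltn.
Qed.

Lemma model_comp_id (b : bool) n x : n < dim x ->
  let u := idto (dim x) (bdn n b x) in
  comp n (if b then u else x) (if b then x else u) = x.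
Proof.
move=> lt u; have du : dim u = dim x.
  by rewrite dim_idto (dim_bdn mX) ?(ltnW lt) //; lia.
have tu : tb u = trunc (tb x) n b by rewrite tb_idto (tb_bdn mX) ?(ltnW lt).
have hc : composable n (if b then u else x) (if b then x else u).
  apply/(composableE mX); case: b @u du tu => u du tu; rewrite ?du tu; split=> //.
    by split=> *; rewrite ?truncE_eq ?truncE_lt.
  by split=> *; rewrite ?truncE_eq ?truncE_lt.
have [d1 t1] := md_comp mX hc; apply: model_ext.
  by rewrite d1; case: b {hc d1 t1} @u du tu.
move=> j c s; rewrite t1 /tcomp; case: b @u du tu {hc d1 t1} => u du tu; rewrite tu /trunc.
  by case: (ltngtP j n) => // ->; rewrite ?ltnn ?eqxx; case: c.
case: (ltngtP j n) => // [|->]; rewrite ?ltnn ?eqxx ?addn0 //; by case: c.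
Qed.

(** Cells with the same dimension and the same table are equal, so each axiom is an
identity between tables, checked level by level. *)
Theorem model_omega_cat : is_omega_cat X.
Proof.
have cE n y x := composableE mX n y x.
split.
- by move=> x /(tb_bd mX false)[].
- by move=> x /(tb_bd mX true)[].
- by move=> x /(model_bd_bd false false).
- by move=> x /(model_bd_bd true false).
- by move=> x; case: (md_idc mX x).
- move=> x; have [d t] := md_idc mX x; have [|d' t'] := bdE false (x := idc x);
  first by rewrite d.
  apply: (tb_inj mX); first by rewrite d' d.
  by rewrite t' d t /= (trunc_id _ (tb_valid mX x)).
- move=> x; have [d t] := md_idc mX x; have [|d' t'] := bdE true (x := idc x);
  first by rewrite d.
  apply: (tb_inj mX); first by rewrite d' d.
  by rewrite t' d t /= (trunc_id _ (tb_valid mX x)).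
- by move=> n y x /(md_comp mX)[].
- by move=> n y x /(model_bd_comp false).
- by move=> n y x /(model_bd_comp true).
- move=> n z y x /[dup] hzy /cE[e1 lt1 [lo1 mid1]] /[dup] hyx /cE[e2 lt2 [lo2 mid2]].
  have [d3 t3] := md_comp mX hzy; have [d4 t4] := md_comp mX hyx.
  have h5 : composable n z (comp n y x).
    apply/cE; rewrite d4 t4 /tcomp; split=> //; first by rewrite e1.
    by split=> [j b s lt|s]; rewrite ?lt ?ltnn ?eqxx // lo2 // lo1.
  have h6 : composable n (comp n z y) x.
    apply/cE; rewrite d3 t3 /tcomp; split=> //.
    by split=> [j b s lt|s]; rewrite ?lt ?ltnn ?eqxx // lo2.
  have [d5 t5] := md_comp mX h5; have [d6 t6] := md_comp mX h6.
  apply: model_ext; first by rewrite d5 d6 d4.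
  move=> j b s; rewrite t5 t6 t3 t4 /tcomp.
  case: (ltngtP j n) => //; first by rewrite addnA.
  by move=> _; rewrite ltnn eqxx; case: b.
- by move=> n x lt; apply: (model_comp_id true lt).
- by move=> n x lt; apply: (model_comp_id false lt).
- move=> n y x /[dup] h /cE[e lt c].
  have [d1 t1] := md_comp mX h.
  have [dx tx] := md_idc mX x; have [dy ty] := md_idc mX y.
  have [d2 t2] := md_idc mX (comp n y x).
  have h3 : composable n (idc y) (idc x).
    by apply/cE; rewrite dx dy tx ty e; split=> //; lia.
  have [d3 t3] := md_comp mX h3.
  by apply: (tb_inj mX); rewrite ?d2 ?d3 ?d1 ?dx // t2 t3 t1 tx ty.
- move=> n k y' y x' x ltnk hy hx hyx.
  have [d1 t1] := md_comp mX hy; have [d2 t2] := md_comp mX hx.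
  have [d3 t3] := md_comp mX hyx.
  have [ey lty [loy midy]] := (cE _ _ _).1 hy.
  have [ex ltx [lox midx]] := (cE _ _ _).1 hx.
  have [eyx ltyx [loyx midyx]] := (cE _ _ _).1 hyx.
  have h4 : composable n y' x'.
    apply/cE; split; try lia; split=> [j b s lt|s].
      by rewrite -lox ?(ltn_trans lt ltnk)// -loy ?(ltn_trans lt ltnk)// loyx.
    by rewrite -lox // midyx loy.
  have [d4 t4] := md_comp mX h4.
  have h5 : composable n (comp k y' y) (comp k x' x).
    apply/cE; rewrite d1 d2 t1 t2 /tcomp; split=> //.
    by split=> [j b s lt|s]; rewrite ?(ltn_trans lt ltnk) ?ltnk //; apply: loyx.
  have h6 : composable k (comp n y' x') (comp n y x).
    apply/cE; rewrite d3 d4 t3 t4 /tcomp ex; split=> //; split=> [j b s lt|s].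
      case: (ltngtP j n) => ltj; first by rewrite lox.
        by rewrite lox // loy.
      by case: b; subst j; rewrite ?lox ?loy.
    by case: (ltngtP k n) ltnk => // _ _; rewrite midx midy.
  have [d5 t5] := md_comp mX h5; have [d6 t6] := md_comp mX h6.
  apply: model_ext; first by rewrite d5 d6 d2 d3.
  move=> j b s; rewrite t5 t6 t1 t2 t3 t4 /tcomp.
  case: (ltngtP j k) => [ltj|ltj|->].
  + by case: (ltngtP j n) => // _; rewrite ltnk.
  + by case: (ltngtP j n) => *; lia.
  + by case: (ltngtP k n) ltnk => // _ _; case: b.
Qed.

End Model.

Section Iso.
Variables (m : nat) (X Y : precat) (tX : X -> table) (tY : Y -> table).
Hypotheses (mX : model m tX) (mY : model m tY).

Lemma model_transfer (x : X) : exists y : Y, dim y = dim x /\ tY y = tX x.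
Proof. exact: (md_surj mY (tb_valid mX x)). Qed.

Definition transfer (x : X) : Y := sval (cid (model_transfer x)).

Lemma dim_transfer x : dim (transfer x) = dim x.
Proof. by rewrite /transfer; case: (cid _) => y []. Qed.

Lemma tb_transfer x : tY (transfer x) = tX x.
Proof. by rewrite /transfer; case: (cid _) => y []. Qed.

Lemma transfer_functor : is_omega_functor transfer.
Proof.
have tbd b x : 0 < dim x -> transfer (bd b x) = bd b (transfer x).
  move=> lt; have [d1 t1] := tb_bd mX b lt.
  have [|d2 t2] := tb_bd mY b (x := transfer x); first by rewrite dim_transfer.
  apply: (tb_inj mY); rewrite ?dim_transfer ?tb_transfer ?d1 ?d2 ?t1 ?t2;
  by rewrite ?dim_transfer ?tb_transfer.
split.
- exact: dim_transfer.
- by move=> x /(tbd false).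
- by move=> x /(tbd true).
- move=> x; have [d1 t1] := md_idc mX x; have [d2 t2] := md_idc mY (transfer x).
  by apply: (tb_inj mY);
    rewrite ?dim_transfer ?tb_transfer ?d1 ?d2 ?t1 ?t2 ?dim_transfer ?tb_transfer.
- move=> n y x h; have [d1 t1] := md_comp mX h.
  have h' : composable n (transfer y) (transfer x).
    by apply/(composableE mY); rewrite !dim_transfer !tb_transfer; apply/(composableE mX).
  have [d2 t2] := md_comp mY h'.
  apply: (tb_inj mY); rewrite ?dim_transfer ?tb_transfer ?d1 ?d2 ?t1 ?t2 ?dim_transfer //.
  by rewrite !tb_transfer.
Qed.

End Iso.

(** The isomorphism sends a cell to the unique cell with the same dimension and table. *)
Theorem model_isomorphic m (X Y : precat) (tX : X -> table) (tY : Y -> table) :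
  model m tX -> model m tY -> isomorphic X Y.
Proof.
move=> mX mY; exists (transfer mX mY), (transfer mY mX); split.
- exact: transfer_functor.
- exact: transfer_functor.
- by move=> x; apply: (tb_inj mX); rewrite ?dim_transfer ?tb_transfer.
- by move=> x; apply: (tb_inj mY); rewrite ?dim_transfer ?tb_transfer.
Qed.

Lemma model_terminal : @model 1 terminal (fun=> apex_table 0).
Proof.
have aE k T : steiner 1 k T -> T = apex_table 0.
  move=> sT; have supp := steiner_supp sT.
  apply: tableP => j b s; rewrite /apex_table.
  have one : T 0 b [:: 0] = 1.
    by have := steiner_aug sT b; rewrite /bdry big_mkcond big_ord_recl big_ord0 /= addn0.
  case: (T j b s =P 0) => [z|/[dup] nz /supp[/andP[srt al] sz]]; last first.
    case: s srt al sz nz => [|u [|v s]] //=.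
      by move=> _; rewrite andbT ltnS leqn0 => /eqP-> [<-].
    by case/andP=> uv _ /andP[_ /andP[lt _]]; lia.
  rewrite z; case: eqP => //= j0; case: eqP => //= s0.
  by move: z; rewrite j0 s0 one.
have sA k : steiner 1 k (apex_table 0) by apply: steiner_apex.
split; first split.
- by move=> x; apply: sA.
- by [].
- move=> b x lt; split; first by case: b.
  by symmetry; apply: aE; apply: steiner_trunc (sA 0).
- by move=> k T /aE ->; exists k.
- by [].
- move=> n y x /= [e lt _]; split=> //.
  by symmetry; apply: (aE x); apply: steiner_tcomp => //; apply: sA.
Qed.

(** * Tables of globes *)

Section GlobeTable.
Variable A : Type.
Implicit Types (c d m p x y : globe A) (f : A -> chain).

Definition gside (b : bool) c := if b then gtgt c else gsrc c.
Definition gbd c j (b : bool) := if b then gtgtn j c else gsrcn j c.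
Definition globe_table f c : table := fun j b s =>
  if j <= gdim c then f (label (gbd c j b)) s else 0.

(** The part of the definitions of cells of the oriental and of the coslice that only
concerns the shape of the globe. *)
Fixpoint globular c : Prop :=
  if c is Arr m p _ then [/\ globular m, globular p & gparallel m p] else True.

Lemma gbdE c j b : gbd c j b = iter (gdim c - j) (gside b) c.
Proof. by rewrite /gbd; case: b. Qed.

Lemma gbd_id c b : gbd c (gdim c) b = c.
Proof. by rewrite gbdE subnn. Qed.

Lemma globular_side b c : globular c -> globular (gside b c).
Proof. by case: b; case: c => // m p l []. Qed.

Lemma gdim_side b c : globular c -> gdim (gside b c) = (gdim c).-1.
Proof. by case: c => [l|m p l [_ _ [e _]]]; case: b. Qed.

Lemma gbd_step c j b : globular c -> j < gdim c -> gbd c j b = gbd (gside b c) j b.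
Proof.
move=> wc lt; rewrite !gbdE gdim_side //.
have -> : gdim c - j = ((gdim c).-1 - j).+1 by lia.
by rewrite iterSr.
Qed.

Lemma gbd_globular c j b : globular c -> globular (gbd c j b).
Proof. by move=> wc; rewrite gbdE; elim: (_ - _) => //= k; apply: globular_side. Qed.

Lemma gdim_bd c j b : globular c -> j <= gdim c -> gdim (gbd c j b) = j.
Proof.
move=> wc le; have : gdim (gbd c j b) = gdim c - (gdim c - j).
  rewrite gbdE; elim: (gdim c - j) => [|k IH] /=; first by rewrite subn0.
  rewrite gdim_side ?IH; first by lia.
  by elim: k {IH} => //= k; apply: globular_side.
lia.
Qed.

(** Parallel cells have the same iterated boundaries in strictly lower dimension. *)
Lemma gbd_par c j b (d : bool) : globular c -> j < (gdim c).-1 ->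
  gbd (gside d c) j b = gbd (gside (~~ d) c) j b.
Proof.
case: c => // m p l /= [wm wp [e par]] lt.
have {}par : gbd m j b = gbd p j b.
  rewrite gbd_step // (gbd_step (c := p)) ?e // -?e //.
  have [|es et] := par; first by lia.
  by case: b; rewrite /gside ?es ?et.
by case: d; rewrite /= par.
Qed.

Lemma gbd_gbd c i j b (d : bool) : globular c -> i < j -> j <= gdim c ->
  gbd (gbd c j d) i b = gbd c i b.
Proof.
move=> + ltij; elim: (gdim c) {-2}c (erefl (gdim c)) => [|k IH] {}c e wc le.
  by move: le ltij; rewrite e; lia.
have [->|ne] := eqVneq j (gdim c); first by rewrite gbd_id.
rewrite (gbd_step (j := j)) ?IH ?gdim_side ?e //; last by lia.
- rewrite (gbd_step (c := c)) //; last by lia.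
  case: (altP (b =P d)) => [->//|nbd].
  have -> : gside b c = gside (~~ d) c by move: (b) (d) nbd => [] [].
  by apply: gbd_par => //; lia.
- exact: globular_side.
- by lia.
Qed.

Lemma globe_table_bd f c j b : globular c -> j <= gdim c ->
  globe_table f (gbd c j b) = trunc (globe_table f c) j b.
Proof.
move=> wc le; apply: tableP => i d s; rewrite /globe_table /trunc gdim_bd // le.
case: (ltngtP i j) => // [lt|->].
  by rewrite gbd_gbd // (leq_trans (ltnW lt) le).
by have := gbd_id (gbd c j b) d; rewrite gdim_bd // => ->.
Qed.

Lemma gside_bd c b : globular c -> 0 < gdim c -> gside b c = gbd c (gdim c).-1 b.
Proof.
by move=> wc lt; rewrite gbd_step ?prednK // -(gdim_side b wc) gbd_id.
Qed.

Lemma globe_table_side f c b : globular c -> 0 < gdim c ->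
  globe_table f (gside b c) = trunc (globe_table f c) (gdim c).-1 b.
Proof. by move=> wc lt; rewrite -globe_table_bd ?leq_pred // gside_bd. Qed.

Lemma globe_table_top f c b s : globe_table f c (gdim c) b s = f (label c) s.
Proof. by rewrite /globe_table leqnn gbd_id. Qed.

Lemma globe_table_hi f c j b s : gdim c < j -> globe_table f c j b s = 0.
Proof. by rewrite ltnNge /globe_table => /negbTE ->. Qed.

Lemma globe_ext c d : globular c -> globular d -> gdim c = gdim d ->
  (forall j b, j <= gdim c -> label (gbd c j b) = label (gbd d j b)) -> c = d.
Proof.
move: {2}(gdim c) (erefl (gdim c)) => k; elim: k c d => [|k IH] c d ek wc wd ed h.
  by case: c d ek ed h {wc wd} => [l|//] [l'|//] _ _ /(_ 0 true isT) /= ->.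
have side b : gside b c = gside b d.
  apply: IH; rewrite ?gdim_side -?ed ?ek //; try exact: globular_side.
  move=> j e le; rewrite !gside_bd -?ed ?ek //=.
  case: (ltngtP j k) le => // [lt _|-> _]; first by rewrite !gbd_gbd -?ed ?ek //; apply: h; lia.
  have := gbd_id (gbd c k b) e; have := gbd_id (gbd d k b) e.
  by rewrite !gdim_bd -?ed ?ek // => -> ->; apply: h; rewrite ek.
have := h (gdim c) true (leqnn _); rewrite {2}ed !gbd_id.
have := side true; have := side false; rewrite ek in ed.
by case: c d ek ed {IH h side wc wd} => [//|m p l] [//|m' p' l'] /= _ _ -> -> ->.
Qed.

(** Sharing the lower levels between source and target makes the result globular for
any family of labels. *)
Fixpoint mkglobe (S : nat -> bool -> A) k b : globe A :=
  if k is j.+1 then Arr (mkglobe S j false) (mkglobe S j true) (S k b)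
  else Pt (S 0 b).

Lemma gdim_mk S k b : gdim (mkglobe S k b) = k.
Proof. by elim: k b => //= k IH b; rewrite IH. Qed.

Lemma mkglobe_par S k : gparallel (mkglobe S k false) (mkglobe S k true).
Proof. by split; [rewrite !gdim_mk|case: k]. Qed.

Lemma mkglobe_globular S k b : globular (mkglobe S k b).
Proof.
elim: k b => //= k IH b; split=> //; exact: mkglobe_par.
Qed.

Lemma label_mk S k b : label (mkglobe S k b) = S k b.
Proof. by case: k. Qed.

Lemma gbd_mk S k b j (c : bool) : j < k -> gbd (mkglobe S k b) j c = mkglobe S j c.
Proof.
elim: k b => // k IH b lt; rewrite gbd_step ?gdim_mk //; last exact: mkglobe_globular.
have -> : gside c (mkglobe S k.+1 b) = mkglobe S k c by case: (c).
case: (ltngtP j k) lt => [ltj _|/leq_ltn_trans h /h|-> _]; [exact: IH| |].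
  by rewrite ltnn.
by have := gbd_id (mkglobe S k c) c; rewrite gdim_mk.
Qed.

Lemma globe_table_mk f S k b : globe_table f (mkglobe S k b) = fun j (e : bool) s =>
  if j < k then f (S j e) s else if j == k then f (S k b) s else 0.
Proof.
apply: tableP => j e s; rewrite /globe_table gdim_mk.
case: (ltngtP j k) => // [lt|->]; first by rewrite gbd_mk // label_mk.
by have := gbd_id (mkglobe S k b) e; rewrite gdim_mk => ->; rewrite label_mk.
Qed.

Lemma globe_table_idc f c l : globular c -> (forall s, f l s = 0) ->
  globe_table f (Arr c c l) = globe_table f c.
Proof.
move=> wc l0; apply: tableP => j b s.
have wc' : globular (Arr c c l) by [].
case: (ltngtP j (gdim c).+1) => [lt|lt|->].
- have /esym := congr1 (fun T : table => T j b s) (globe_table_side f b wc' isT).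
  have -> : gside b (Arr c c l) = c by case: (b).
  rewrite /trunc /=.
  move: lt; rewrite ltnS leq_eqVlt => /orP[/eqP->|->] //.
  by rewrite ltnn eqxx.
- by rewrite !globe_table_hi //= ltnW.
- by rewrite (globe_table_top f (Arr c c l)) l0 globe_table_hi.
Qed.

(** A criterion for the formal composite to be a given globe e, in terms of iterated
boundaries only.  It makes it unnecessary to prove that the formal composite
satisfies the conditions on cells: these are inherited from e. *)
Lemma gcomp_eq (f : nat -> globe A -> globe A -> A) n e y x :
  globular e -> globular y -> globular x -> gdim e = gdim x -> gdim y = gdim x -> n < gdim x ->
  gbd e n false = gbd x n false -> gbd e n true = gbd y n true ->
  (forall j b, n < j <= gdim x -> label (gbd e j b) = f n (gbd y j b) (gbd x j b)) ->
  gcomp f n y x = e.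
Proof.
elim: e y x => [l|me IHm pe IHp l] [?|my py ly] [?|mx px lx] //.
move=> we wy wx ee ey lt hf ht hl.
have {}hl : l = f n (Arr my py ly) (Arr mx px lx) /\
    (forall j b, n < j <= gdim mx -> label (gbd (Arr me pe l) j b) =
       f n (gbd (Arr my py ly) j b) (gbd (Arr mx px lx) j b)).
  split; last by move=> j b h; apply: hl => /=; lia.
  have := hl (gdim mx).+1 true; rewrite [_ && _]/= lt leqnn => /(_ isT).
  have := gbd_id (Arr me pe l) true; rewrite ee => ->.
  have := gbd_id (Arr my py ly) true; rewrite ey => ->.
  by have := gbd_id (Arr mx px lx) true => ->.
case: hl => /= <- hl; move: ee ey lt => /= [ee] [ey]; rewrite ltnS => lt.
have sd (m p : globe A) k b : globular (Arr m p k) ->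
  gbd (Arr m p k) (gdim m) b = if b then p else m.
  by move=> w; rewrite -[gdim m]/(gdim (Arr m p k)).-1 -gside_bd //; case: b.
have [[wme wpe [eme _]] [wmy wpy [emy _]] [wmx wpx [emx _]]] := And3 we wy wx.
case: eqP => [en|/eqP ne].
  have hm : me = mx by rewrite -(sd _ _ _ false we) -(sd _ _ _ false wx) ee -en.
  have hp : pe = py by rewrite -(sd _ _ _ true we) -(sd _ _ _ true wy) ee ey -en.
  by rewrite hm hp.
have {ne}lt : n < gdim mx by rewrite ltn_neqAle ne.
have sub (b : bool) j (d : bool) (m p : globe A) k : globular (Arr m p k) ->
  gdim m = gdim mx -> j <= gdim mx ->
    gbd (if b then p else m) j d = gbd (Arr m p k) j (if j < gdim mx then d else b).
  move=> w em le; rewrite -(sd m p k b w); case: ltngtP le => // [ltj _|-> _].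
    by rewrite gbd_gbd ?em //= em.
  rewrite -em; have := gbd_id (gbd (Arr m p k) (gdim m) b) d.
  by rewrite gdim_bd /=.
have side (b : bool) : gcomp f n (if b then py else my) (if b then px else mx) =
  if b then pe else me.
  have IH : forall y x, globular (if b then pe else me) -> globular y -> globular x ->
     gdim (if b then pe else me) = gdim x ->
     gdim y = gdim x -> n < gdim x ->
     gbd (if b then pe else me) n false = gbd x n false ->
       gbd (if b then pe else me) n true = gbd y n true ->
     (forall j (d : bool), n < j <= gdim x ->
       label (gbd (if b then pe else me) j d) = f n (gbd y j d) (gbd x j d)) ->
     gcomp f n y x = if b then pe else me by case: (b).
  have dx : gdim (if b then px else mx) = gdim mx by case: (b).
  have dy : gdim (if b then py else my) = gdim mx by case: (b); rewrite -?emy.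
  have de : gdim (if b then pe else me) = gdim mx by case: (b); rewrite -?eme.
  apply: IH; rewrite ?dx ?dy ?de //; try by case: (b).
  - by rewrite (sub _ _ _ _ _ _ we) ?(sub _ _ _ _ _ _ wx) // ?(ltnW lt) // lt.
  - by rewrite (sub _ _ _ _ _ _ we) ?(sub _ _ _ _ _ _ wy) // ?(ltnW lt) // lt.
  - move=> j c /andP[ltj le];
    rewrite (sub _ _ _ _ _ _ we) ?(sub _ _ _ _ _ _ wy) ?(sub _ _ _ _ _ _ wx) //.
    by apply: hl; rewrite ltj le.
by rewrite (side false) (side true).
Qed.

End GlobeTable.

Lemma clampE (A : Type) (P : globe A -> Prop) d c : P c -> sval (@clamp A P d c) = c.
Proof. by rewrite /clamp; case: pselect. Qed.

Lemma sval_inj (A : Type) (P : A -> Prop) (u v : {x | P x}) : sval u = sval v -> u = v.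
Proof.
case: u v => [x px] [y py] /= e; subst y; congr exist; exact: Prop_irrelevance.
Qed.

(** * The oriental *)

Definition face (b : bool) (a : seq nat) := if b then minus a else plus a.
Definition faceS (b : bool) (xi : {fset seq nat}) := if b then minusS xi else plusS xi.
Definition indicator (xi : {fset seq nat}) : chain := fun s => nat_of_bool (s \in xi).

Local Notation set_table := (globe_table indicator).


Lemma faceP b a s :
  reflect (exists k, [/\ k < size a, odd k = b & s = omit k a]) (s \in face b a).
Proof.
apply: (iffP idP) => [|[k [lt ok ->]]].
  by rewrite /face; case: b => /imfsetP[k /=];
    rewrite mem_filter mem_iota /= => /andP[ok lt] ->;
     exists k; split=> //; apply/negbTE.
by rewrite /face; case: b ok => ok; apply/imfsetP; exists k => //=;
  rewrite mem_filter mem_iota ok.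
Qed.

Lemma faceSP b xi s :
  reflect (exists2 a, a \in xi & s \in face b a) (s \in faceS b xi).
Proof.
apply: (iffP idP) => [|[a ax sa]].
  by rewrite /faceS; case: b => /bigfcupP[a]; rewrite andbT => ax sa; exists a.
by rewrite /faceS; case: b sa => sa; apply/bigfcupP; exists a; rewrite ?andbT.
Qed.

Lemma face_simplex m b a s : is_simplex m a -> s \in face b a -> is_simplex m s.
Proof.
move=> /andP[srt /allP al] /faceP[k [_ _ ->]].
have sub : subseq (omit k a) a.
  rewrite -{2}(cat_take_drop k a); apply: cat_subseq => //.
  by rewrite -add1n -drop_drop; apply: drop_subseq.
rewrite /is_simplex (subseq_sorted ltn_trans sub srt).
by apply/allP => u /(mem_subseq sub) /al.
Qed.

Lemma simplex_split m v s : is_simplex m s -> v \notin s ->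
  s = [seq u <- s | u < v] ++ [seq u <- s | v < u].
Proof.
move=> /andP[srt _] nv; apply: (irr_sorted_eq ltn_trans ltnn) => //.
  rewrite (sorted_pairwise ltn_trans) pairwise_cat -!(sorted_pairwise ltn_trans).
  rewrite !(sorted_filter ltn_trans) // !andbT.
  by apply/allrelP => x y; rewrite !mem_filter => /andP[xv _] /andP[/(ltn_trans xv)].
move=> u; rewrite mem_cat !mem_filter -andb_orl.
case us: (u \in s); rewrite ?andbF ?andbT //; case: ltngtP => // e.
by rewrite -e us in nv.
Qed.

(** Translates between deleting the k-th vertex of a and inserting a vertex into s;
since both are increasing, k is the number of vertices of s below the new one. *)
Lemma face_insert m b a s : is_simplex m a -> is_simplex m s ->
  (s \in face b a) <->
  exists v, [/\ v < m, v \notin s, odd (count (fun u => u < v) s) = b & a = insert v s].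
Proof.
move=> ga gs; split=> [/faceP[k [lt ok es]]|[v [lt nv ov ea]]].
  set v := nth 0 a k.
  have ea : a = take k a ++ v :: drop k.+1 a by rewrite -drop_nth // cat_take_drop.
  have [srt al] := andP ga.
  have : pairwise ltn a by rewrite -(sorted_pairwise ltn_trans).
  rewrite {1}ea pairwise_cat => /and3P[/allrelP h _ /= /andP[/allP h2 _]].
  have h1 u : u \in take k a -> u < v by move=> ut; apply: h; rewrite ?mem_head.
  have f1 : [seq u <- s | u < v] = take k a.
    rewrite es filter_cat (all_filterP _); last by apply/allP.
    rewrite (_ : filter _ _ = [::]) ?cats0 //; apply/eqP.
    rewrite -[_ == _]negbK -has_filter; apply/negP => /hasP[u /h2 /=]; lia.
  have f2 : [seq u <- s | v < u] = drop k.+1 a.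
    rewrite es filter_cat [X in _ ++ X](all_filterP _); last by apply/allP.
    rewrite (_ : [seq u <- take k a | _] = [::]) //; apply/eqP.
    rewrite -[_ == _]negbK -has_filter; apply/negP => /hasP[u /h1 /=]; lia.
  exists v; split.
  - by apply: (allP al); apply: mem_nth.
  - rewrite es /omit mem_cat; by apply/norP; split; apply/negP;
    [move=> /h1|move=> /h2] => /=; rewrite ltnn.
  - by rewrite -size_filter f1 size_take lt.
  - by rewrite /insert f1 f2.
apply/faceP; exists (count (fun u => u < v) s).
rewrite ea /insert -size_filter in ov *; split=> //.
  by rewrite size_cat /= addnS ltnS leq_addr.
rewrite /omit take_size_cat // drop_cat ltnNge leqnSn /= subSnn /= drop0.
exact: simplex_split gs nv.
Qed.

Lemma bdry_card m b xi s : bdry m b (indicator xi) s =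
  #|[pred v : 'I_m | [&& nat_of_ord v \notin s,
      odd (count (fun u => u < v) s) == b & insert v s \in xi]]|.
Proof.
rewrite -sum1_card /bdry [RHS](eq_bigl (fun v : 'I_m =>
  ((nat_of_ord v \notin s) && (odd (count (fun u => u < v) s) == b)) && (insert v s \in xi))).
  by rewrite [RHS]big_mkcondr; apply: eq_bigr => v _; rewrite /indicator; case: (_ \in _).
by move=> v; rewrite inE andbA.
Qed.

Section Faces.
Variables (m : nat) (xi : {fset seq nat}).
Hypothesis gxi : forall a, a \in xi -> is_simplex m a.

Lemma bdry_gt0 b s : is_simplex m s -> (0 < bdry m b (indicator xi) s) = (s \in faceS b xi).
Proof.
move=> gs; rewrite bdry_card; apply/card_gt0P/faceSP => [[v]|[a ax]].
  rewrite inE => /and3P[nv /eqP ov vx]; exists (insert v s) => //.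
  by apply/(face_insert _ (gxi vx) gs); exists v.
move=> /(face_insert _ (gxi ax) gs)[v [lt nv ov ea]]; exists (Ordinal lt).
by rewrite inE /= nv ov eqxx -ea.
Qed.

(** The coefficient at s of the faces of xi counts the simplices of xi having s as a
face. *)
Lemma bdry_le1 b :
  (forall s, is_simplex m s -> bdry m b (indicator xi) s <= 1) <->
  (forall a a', a \in xi -> a' \in xi -> a <> a' -> (face b a `&` face b a')%fset = fset0).
Proof.
split=> [h a a' ax ax' ne|h s gs].
  apply/fsetP => s; rewrite inE in_fset0; apply/negP => /andP[sa sa'].
  have gs := face_simplex (gxi ax) sa.
  have [v [ltv nv ov ev]] := (face_insert b (gxi ax) gs).1 sa.
  have [w [ltw nw ow ew]] := (face_insert b (gxi ax') gs).1 sa'.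
  have := h s gs; rewrite bdry_card => /card_le1_eqP /(_ (Ordinal ltv) (Ordinal ltw)).
  rewrite !inE /= nv nw ov ow !eqxx -ev -ew ax ax' => /(_ isT isT) [evw].
  by case: ne; rewrite ev ew evw.
rewrite bdry_card; apply/card_le1_eqP => v w; rewrite !inE.
move=> /and3P[nv /eqP ov vx] /and3P[nw /eqP ow wx]; apply: val_inj => /=.
apply/eqP/negP => /negP nvw.
have /fsetP/(_ s) : (face b (insert v s) `&` face b (insert w s))%fset = fset0.
  apply: h => // e; have : nat_of_ord v \in insert w s by rewrite -e mem_cat mem_head orbT.
  by rewrite mem_cat in_cons !mem_filter (negbTE nv) !andbF orbF /= eq_sym (negbTE nvw).
rewrite inE in_fset0 => /negP[]; apply/andP; split.
  by apply/(face_insert _ (gxi vx) gs); exists v.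
by apply/(face_insert _ (gxi wx) gs); exists w.
Qed.

End Faces.

Lemma simplexE n j a : simplex n j a = is_simplex n.+1 a && (size a == j.+1).
Proof. by rewrite /simplex /is_simplex -andbA; congr (_ && _); rewrite andbC. Qed.

Lemma oriental_globular n c : oriental_cell n c -> globular c.
Proof. by elim: c => //= m IHm p IHp l [[/IHm ? /IHp ? ?] _]. Qed.

(** The two set equations of a cell say that source and positive faces are disjoint,
that target and negative faces are disjoint, and that the two unions agree; with
the disjointness of faces this is the equation between chains. *)
Lemma oriental_steiner n c : oriental_cell n c -> steiner n.+1 (gdim c) (set_table c).
Proof.
elim: c => [l|m IHm p IHp xi].
  move=> /= [i lei el];
    have lab j b s : set_table (Pt l) j b s = (j == 0) && (s == [:: i]) :> nat.
    by rewrite /globe_table /= leqn0; case: eqP => // ->; rewrite /gbd; case: b;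
      rewrite /= /indicator el inE.
  split.
  - move=> j b s; rewrite lab; case: eqP => // ->; case: eqP => // -> _.
    by rewrite /is_simplex /= ltnS lei.
  - by [].
  - by case=> // j b s; rewrite lab.
  - move=> b; have lt : i < n.+1 by [].
    rewrite /bdry big_mkcond (bigD1 (Ordinal lt)) //= lab big1 => [|v nv];
      first by rewrite /insert /= eqxx.
    rewrite lab /= /insert /= eqseq_cons andbT; case: eqP => // e.
    by case/eqP: nv; apply: val_inj.
  - by move=> j b s gs; rewrite !bdry0 // => t; rewrite ?lab //.
move=> oc; have wc := oriental_globular oc;
  move: oc => /= [[/IHm sm /IHp sp [emp par]] [sx [disj [ep em]]]].
have gx a : a \in xi -> is_simplex n.+1 a by move=> /sx; rewrite simplexE => /andP[].
set c := Arr m p xi; have dc : gdim c = (gdim m).+1 by [].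
have side b : trunc (set_table c) (gdim m) b = set_table (if b then p else m).
  by rewrite -[gdim m]/((gdim c).-1) -globe_table_side //; case: b.
have st b : steiner n.+1 (gdim m) (trunc (set_table c) (gdim m) b).
  by rewrite side; case: b; rewrite // emp.
have top b s : set_table c (gdim m).+1 b s = indicator xi s by rewrite -dc globe_table_top.
have hi j b s : (gdim m).+1 < j -> set_table c j b s = 0 by move=> h; apply: globe_table_hi.
have le1 b s : is_simplex n.+1 s -> bdry n.+1 b (indicator xi) s <= 1.
  move: s; apply/(bdry_le1 gx) => a a' ax ax' /(disj _ _ ax ax')[].
  by case: b.
have tm b s : set_table c (gdim m) b s = indicator (label (if b then p else m)) s.
  have := congr1 (fun T : table => T (gdim m) b s) (side b).
  by rewrite truncE_eq => ->; case: b; rewrite ?globe_table_top // emp globe_table_top.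
split.
- move=> j b s; case: (ltngtP j (gdim m).+1) => [lt|/hi ->//|->].
    have := steiner_supp (st b) (j := j) (b := b) (s := s).
    rewrite /trunc; move: lt; rewrite ltnS leq_eqVlt => /orP[/eqP->|lt].
      by rewrite ltnn eqxx.
    by rewrite lt.
  rewrite top /indicator; case sxi: (s \in xi) => // _.
  by have := sx _ sxi; rewrite simplexE => /andP[? /eqP].
- by move=> s; rewrite !top.
- by move=> j b s /hi.
- move=> b; have := steiner_aug (st b) b; rewrite /trunc.
  by case: (posnP (gdim m)) => [e|//]; rewrite e.
- move=> j b s gs; case: (ltngtP j (gdim m)) => [lt|lt|->].
  + have := steiner_bdry (st b) j b gs; rewrite /trunc lt.
    by case: (ltngtP j.+1 (gdim m)) lt => // e _; rewrite -e.
  + have eb e : bdry n.+1 e (set_table c j.+1 b) s = 0.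
      by apply: bdry0 => t; apply: hi; lia.
    rewrite !eb.
    case: (ltngtP j (gdim m).+1) lt => // [lt _|-> _]; [by rewrite !hi|by rewrite !top].
  have eb e : bdry n.+1 e (set_table c (gdim m).+1 b) s = bdry n.+1 e (indicator xi) s.
    by apply: eq_bdry => v _; apply: top.
  rewrite !tm !eb.
  have := congr1 (fun l : {fset seq nat} => s \in l) ep.
  have := congr1 (fun l : {fset seq nat} => s \in l) em.
  rewrite !inE -[plusS xi]/(faceS false xi) -[minusS xi]/(faceS true xi) /indicator.
  rewrite -!(bdry_gt0 gx) //; move: (le1 false s gs) (le1 true s gs).
  case: (s \in label m); case: (s \in label p);
  case: (bdry _ _ _ s) => [|[]] //; case: (bdry _ _ _ s) => [|[]] //.
Qed.

(** By [steiner_le1] both sides of the equation between chains are indicator functions,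
so that the equation splits into the two set equations. *)
Lemma steiner_oriental n c : globular c -> steiner n.+1 (gdim c) (set_table c) ->
  oriental_cell n c.
Proof.
elim: c => [l|m IHm p IHp xi].
  move=> _ st; have lab b s : set_table (Pt l) 0 b s = indicator l s by case: b.
  have := steiner_aug st true.
  have -> : bdry n.+1 false (set_table (Pt l) 0 true) [::] = bdry n.+1 false (indicator l) [::].
    by apply: eq_bdry => v _; apply: lab.
  move=> aug; have : 0 < bdry n.+1 false (indicator l) [::] by rewrite aug.
  rewrite bdry_card => /card_gt0P[v]; rewrite inE /= /insert /= => vl.
  have := aug; rewrite bdry_card => e; have := leqnn 1; rewrite -{1}e => /card_le1_eqP uq.
  exists v => //; first by rewrite -ltnS.
  apply/fsetP => s; rewrite inE; apply/idP/eqP => [sl|-> //].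
  have [|] := steiner_supp st (j := 0) (b := true) (s := s); first by rewrite lab /indicator sl.
  case: s sl => [|u [|]] // ul /andP[_ /= /andP[ltu _]] _.
  have := uq v (Ordinal ltu); rewrite !inE /= /insert /= vl ul => /(_ isT isT) e'.
  by rewrite -e'.
move=> /[dup] wc /= [wm wp /[dup] par [emp _]] st.
set c := Arr m p xi in wc; have dc : gdim c = (gdim m).+1 by [].
have side b : set_table (if b then p else m) = trunc (set_table c) (gdim m) b.
  by rewrite -[gdim m]/((gdim c).-1) -globe_table_side //; case: b.
have om : oriental_cell n m.
  by apply: IHm => //; rewrite (side false); apply: steiner_trunc st.
have op : oriental_cell n p.
  by apply: IHp => //; rewrite -emp (side true); apply: steiner_trunc st.
have top b s : set_table c (gdim m).+1 b s = indicator xi s by rewrite -dc globe_table_top.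
have tm b s : set_table c (gdim m) b s = indicator (label (if b then p else m)) s.
  have := congr1 (fun T : table => T (gdim m) b s) (side b).
  by rewrite truncE_eq => <-; case: b; rewrite ?globe_table_top // emp globe_table_top.
have sx a : a \in xi -> is_simplex n.+1 a /\ size a = (gdim m).+2.
  by move=> ax; apply: (steiner_supp st (b := true)); rewrite top /indicator ax.
have gx a : a \in xi -> is_simplex n.+1 a by case/sx.
have eb s e : bdry n.+1 e (set_table c (gdim m).+1 true) s = bdry n.+1 e (indicator xi) s.
  by apply: eq_bdry => v _; apply: top.
have eq1 s : is_simplex n.+1 s -> indicator (label m) s + bdry n.+1 false (indicator xi) s =
    indicator (label p) s + bdry n.+1 true (indicator xi) s.
  by move=> gs; have := steiner_bdry st (gdim m) true gs; rewrite !eb !tm.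
have le1 s : is_simplex n.+1 s -> indicator (label m) s + bdry n.+1 false (indicator xi) s <= 1.
  by move=> gs; have := steiner_le1 st (gdim m) true gs; rewrite !eb !tm.
have labg b s : s \in label (if b then p else m) -> is_simplex n.+1 s.
  by move=> sl; apply: (steiner_supp st (j := gdim m) (b := b) _).1; rewrite tm /indicator sl.
have facg b s : s \in faceS b xi -> is_simplex n.+1 s.
  by case/faceSP=> a /gx; apply: face_simplex.
have key s : ((s \in label p) =
  ((s \in label m) || (s \in faceS false xi)) && (s \notin faceS true xi)) /\
   ((s \in label m) = ((s \in label p) || (s \in faceS true xi)) && (s \notin faceS false xi)).
  have [gs|ng] := boolP (is_simplex n.+1 s); last first.
    have nl b : (s \in label (if b then p else m)) = false by apply: contraNF ng; apply: labg.
    have nf b : (s \in faceS b xi) = false by apply: contraNF ng; apply: facg.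
    by rewrite !nf (nl true) (nl false).
  rewrite -!(bdry_gt0 gx) //; move: (eq1 s gs) (le1 s gs); rewrite /indicator.
  case: (s \in label m); case: (s \in label p);
  case: (bdry _ _ _ s) => [|[]] //; case: (bdry _ _ _ s) => [|[]] //.
split=> //; split; first by move=> a /sx[ga sa]; rewrite simplexE ga sa eqxx.
split.
  move=> a b ax bx ne; split.
    apply: ((bdry_le1 gx false).1 _ a b ax bx ne) => s gs; move: (le1 s gs); lia.
  apply: ((bdry_le1 gx true).1 _ a b ax bx ne) => s gs; move: (eq1 s gs) (le1 s gs); lia.
by split; apply/fsetP => s; rewrite !inE andbC; case: (key s).
Qed.

Lemma indicator_inj l l' : indicator l =1 indicator l' -> l = l'.
Proof.
by move=> e; apply/fsetP => s; move: (e s); rewrite /indicator; case: (_ \in _);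
  case: (_ \in _).
Qed.

Lemma simplex_mask m s : is_simplex m s -> s = mask [seq u \in s | u <- iota 0 m] (iota 0 m).
Proof.
move=> /andP[srt /allP al]; rewrite -filter_mask.
apply: (irr_sorted_eq ltn_trans ltnn) => //.
  exact: (sorted_filter ltn_trans _ (iota_ltn_sorted 0 m)).
by move=> u; rewrite mem_filter mem_iota; case us: (u \in s); rewrite //= al.
Qed.

(** Simplices are enumerated as the subsequences of [iota 0 m], since the support has
to be a finite set. *)
Definition support m (f : chain) : {fset seq nat} :=
  [fset s in [seq mask (val t) (iota 0 m) | t : m.-tuple bool] | f s != 0]%fset.

Lemma mem_support m f s : (f s <> 0 -> is_simplex m s) -> (s \in support m f) = (f s != 0).
Proof.
move=> h; rewrite !inE /=; case: eqP => [_|/h gs]; first by rewrite andbF.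
rewrite andbT; apply/imageP; have sz : size [seq u \in s | u <- iota 0 m] == m.
  by rewrite size_map size_iota.
by exists (Tuple sz) => //=; apply: simplex_mask.
Qed.

Lemma indicator_support m (f : chain) : (forall s, f s <> 0 -> is_simplex m s) ->
  (forall s, f s <= 1) ->
  indicator (support m f) = f.
Proof.
move=> supp le1; apply: funext => s; rewrite /indicator mem_support; last exact: supp.
by move: (le1 s); case: (f s) => [|[|]].
Qed.

Lemma steiner_chain_le1 m k T j b s : steiner m k T -> T j b s <= 1.
Proof.
move=> st; case: (T j b s =P 0) => [->//|/(steiner_supp st)[gs _]].
have := steiner_le1 st j true gs; have := steiner_bdry st j true gs.
by case: b; lia.
Qed.

Lemma oriental_surj n k T : steiner n.+1 k T ->
  exists c, [/\ oriental_cell n c, gdim c = k & set_table c = T].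
Proof.
move=> st; pose S j b := support n.+1 (T j b).
have e j b : indicator (S j b) = T j b.
  apply: indicator_support => s; first by case/(steiner_supp st).
  exact: steiner_chain_le1 st.
have et : set_table (mkglobe S k true) = T.
  by rewrite globe_table_mk -[RHS](trunc_id true st); apply: tableP => j b s; rewrite /trunc !e.
exists (mkglobe S k true); rewrite gdim_mk; split=> //.
by apply: steiner_oriental; rewrite ?gdim_mk ?et //; apply: mkglobe_globular.
Qed.

Lemma oriental_inj c d : globular c -> globular d -> gdim c = gdim d ->
  set_table c = set_table d -> c = d.
Proof.
move=> wc wd e et; apply: globe_ext => // j b le; apply: indicator_inj => s.
by have := congr1 (fun T : table => T j b s) et; rewrite /globe_table -e le.
Qed.

Definition oriental_label (_ : nat) (y x : globe {fset seq nat}) := (label y `|` label x)%fset.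

(** The sum of the indicators of the two labels is an indicator, namely that of the
label of e, so the labels are disjoint and their sum is their union. *)
Lemma oriental_gcomp n e y x : globular e -> globular y -> globular x ->
  gdim e = gdim x -> gdim y = gdim x -> n < gdim x ->
  tcompat n (set_table y) (set_table x) ->
  set_table e = tcomp n (set_table y) (set_table x) ->
  gcomp oriental_label n y x = e.
Proof.
move=> we wy wx ex yx lt cpt et; have le := ltnW lt.
apply: gcomp_eq => //.
- apply: oriental_inj; try exact: gbd_globular; first by rewrite !gdim_bd ?ex.
  by rewrite !globe_table_bd ?ex // et trunc_tcomp_src.
- apply: oriental_inj; try exact: gbd_globular; first by rewrite !gdim_bd ?ex ?yx.
  by rewrite !globe_table_bd ?ex ?yx // et trunc_tcomp_tgt.
- move=> j b /andP[ltj lej]; apply: indicator_inj => s.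
  have := congr1 (fun T : table => T j b s) et.
  rewrite /tcomp ltnNge (ltnW ltj) /= gtn_eqF // /globe_table ex yx lej.
  by rewrite /indicator inE; case: (_ \in _); case: (_ \in _); case: (_ \in _).
Qed.

Definition oriental_table n (u : oriental n) : table := set_table (sval u).

(** Composites are cells because their tables are Steiner tables, and Steiner tables
are realised by cells. *)
Lemma oriental_model n : model n.+1 (@oriental_table n).
Proof.
have wf (u : oriental n) : globular (sval u) by apply: oriental_globular (svalP u).
have side b (u : oriental n) : oriental_cell n (gside b (sval u)).
  by case: u => -[l|m p l] oc; case: b; rewrite //=; case: oc => -[].
have bdE b (u : oriental n) : sval (bd b u) = gside b (sval u).
  by case: b; apply: clampE; [apply: (side true)|apply: (side false)].
have st (u : oriental n) : steiner n.+1 (dim u) (oriental_table u).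
  exact: oriental_steiner (svalP u).
have tab : tabulated n.+1 (@oriental_table n).
  split=> // [u v e et|b u lt].
    by apply: sval_inj; apply: oriental_inj.
  rewrite /oriental_table bdE; split; last exact: globe_table_side.
  by rewrite -(gdim_side b) // -bdE.
split=> //.
- move=> k T /oriental_surj[c [oc dc tc]]; by exists (exist _ c oc).
- move=> u; have i0 s : indicator fset0 s = 0 by rewrite /indicator in_fset0.
  have e : sval (idc u) = Arr (sval u) (sval u) fset0.
    have wu := wf u; apply: clampE; apply: steiner_oriental; first by [].
    by rewrite globe_table_idc //; apply: steiner_idc (st u).
  split; first by rewrite [LHS]/(gdim (sval (idc u))) e.
  by rewrite /oriental_table e globe_table_idc.
- move=> k v u /(composableE tab)[ed lt cpt].
  have sv : steiner n.+1 (dim u) (oriental_table v) by rewrite -ed.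
  have /oriental_surj[c [oc dc tc]] := steiner_tcomp lt cpt sv (st u).
  have e : sval (comp k v u) = c.
    have ec := oriental_gcomp (oriental_globular oc) (wf v) (wf u) dc ed lt cpt tc.
    by rewrite [LHS]clampE;
      rewrite -[gcomp _ _ _ _]/(gcomp oriental_label k (sval v) (sval u)) ec.
  split; first by rewrite [LHS]/(gdim (sval (comp k v u))) e.
  by rewrite /oriental_table e.
Qed.

(** * Tables of iterated whiskerings *)

(** The table of [whisker i c z], where N collects the top chains of the second
components of the boundaries of c and Z is the table of z.  Below level i the
whiskerings have already produced the boundary of a second component; at level i
only the last whiskering cell contributes, with its top chain; it is the second
component of the source or of the target of level i-1, according to the parity of
i.  For i = 0 the term N must vanish, as it does for [bar_part]. *)
Definition whisker_table i (N Z : table) : table := fun j b s =>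
  if j < i then bar_of N Z j b s
  else if j == i then Z j b s + N j (~~ odd j) s else Z j b s.

(** On the side where the coslice does not whisker, the boundary of the second
component is the second component of the boundary. *)
Lemma bar_trunc_keep n N Z :
  bar_of (trunc N n.+1 (~~ odd n)) (trunc Z n (~~ odd n)) = trunc (bar_of N Z) n.+1 (~~ odd n).
Proof.
apply: tableP => j b s; rewrite /bar_of /trunc /=.
case: (ltngtP j n) => [lt|lt|->].
- by rewrite ltnS (ltnW lt).
- rewrite ltnNge lt /=; case: eqP => [->|_]; last by rewrite if_same.
  by rewrite if_same /=; case: (odd n).
- by rewrite ltnSn; case: (b =P ~~ odd n) => // ->.
Qed.

(** On the other side, the boundary of the second component is the full whiskering of
the first component. *)
Lemma whisker_table_top n N Z : (forall b s, Z n.+1 b s = Z n.+1 (odd n) s) ->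
  (forall j b s, n.+1 < j -> Z j b s = 0) ->
  whisker_table n.+1 N Z = trunc (bar_of N Z) n.+1 (odd n).
Proof.
move=> top hi; apply: tableP => j b s; rewrite /whisker_table /trunc.
case: (ltngtP j n.+1) => [//|lt|->]; first by rewrite hi.
by rewrite /bar_of /= negbK eqxx top addnC.
Qed.

(** B is the table of the second component of the i-source, by which the coslice
whiskers at even i. *)
Lemma whisker_table_even i N Z W B : ~~ odd i ->
  B = bar_of (trunc N i.+1 false) (trunc Z i false) ->
  (forall j b s, j < i.+1 -> W j b s = Z j b s) ->
  tcompat i (whisker_table i N W) B /\ tcomp i (whisker_table i N W) B = whisker_table i.+1 N W.
Proof.
move=> ei -> eW; split.
  split=> [j b s lt|s]; rewrite /whisker_table /bar_of /trunc.
    by rewrite lt ltnS (ltnW lt) eW // ltnW.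
  by rewrite ltnSn !ltnn !eqxx ei /= eW // addnC.
apply: tableP => j b s; rewrite /tcomp /whisker_table /bar_of /trunc.
case: (ltngtP j i) => [lt|lt|->].
- by rewrite ltnS (ltnW lt) eW // ltnW.
- rewrite ltnNge lt /=; case: eqP => [->|_]; last by rewrite if_same !addn0.
  by rewrite if_same addn0 /= negbK (negbTE ei).
- by rewrite ltnSn ltnn !eqxx ei /=; case: b; rewrite /= ?addn0 // addnC.
Qed.

(** B is the table of the second component of the i-target, by which the coslice
whiskers at odd i. *)
Lemma whisker_table_odd i N Z W B : odd i ->
  B = bar_of (trunc N i.+1 true) (trunc Z i true) ->
  (forall j b s, j < i.+1 -> W j b s = Z j b s) ->
  tcompat i B (whisker_table i N W) /\ tcomp i B (whisker_table i N W) = whisker_table i.+1 N W.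
Proof.
move=> oi -> eW; split.
  split=> [j b s lt|s]; rewrite /whisker_table /bar_of /trunc.
    by rewrite lt ltnS (ltnW lt) eW // ltnW.
  by rewrite ltnSn !ltnn !eqxx oi /= eW // addnC.
apply: tableP => j b s; rewrite /tcomp /whisker_table /bar_of /trunc.
case: (ltngtP j i) => [lt|lt|->].
- by rewrite ltnS (ltnW lt).
- rewrite ltnNge lt /=; case: eqP => [->|_]; last by rewrite if_same.
  by rewrite if_same addn0 /= negbK oi addnC.
- by rewrite ltnSn ltnn !eqxx oi /=; case: b; rewrite /= ?addn0 // addnC.
Qed.

Section BarComp.
Variables (n : nat) (Ny Nx Zy Zx : table).
Hypotheses (cN : tcompat n.+1 Ny Nx) (cZ : tcompat n Zy Zx).

Let Sn_lt : (n.+1 < n) = false. Proof. by rewrite ltnNge leqnSn. Qed.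
Let Sn_eq : (n.+1 == n) = false. Proof. by rewrite gtn_eqF. Qed.

(** The composition formula of the coslice along an even level, at the level of tables.
The whiskered (n+1)-source of y supplies, at level n, the term Z that the target
of the composite must contain and, at level n+1, the one missing from the source. *)
Lemma bar_comp_even : ~~ odd n ->
  let V := tcomp n (whisker_table n Nx (trunc Zy n.+1 false)) (bar_of Nx Zx) in
  [/\ tcompat n (whisker_table n Nx (trunc Zy n.+1 false)) (bar_of Nx Zx),
      tcompat n.+1 (bar_of Ny Zy) V &
      tcomp n.+1 (bar_of Ny Zy) V = bar_of (tcomp n.+1 Ny Nx) (tcomp n Zy Zx)].
Proof.
move: cN cZ => [loN midN] [loZ midZ] en V; rewrite {}/V; split.
- split=> [j b s lt|s]; rewrite /whisker_table /bar_of /trunc.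
    by rewrite lt ltnS (ltnW lt) loZ.
  by rewrite ltnSn ltnn eqxx en /= midZ addnC.
- split=> [j b s lt|s]; rewrite /tcomp /whisker_table /bar_of /trunc.
    rewrite lt loN //; case: (ltngtP j n) lt => [lt _|lt|-> _].
    + by rewrite loZ.
    + by rewrite ltnS leqNgt lt.
    + by rewrite (negbTE en) ltnn eqxx ltnSn /=; case: b; rewrite ?addn0 ?loN // addnC.
  by rewrite !Sn_lt !Sn_eq !ltnn !eqxx /= (negbTE en) /= midN; lia.
- apply: tableP => j b s; rewrite /tcomp /whisker_table /bar_of /trunc.
  case: (ltngtP j n.+1) => [lt|lt|->].
  + case: (ltngtP j n) lt => [//|lt|-> _]; first by rewrite ltnS leqNgt lt.
    by rewrite (negbTE en) ltnn eqxx ltnSn; case: b => /=; rewrite ?addn0 // addnC.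
  + rewrite ltnNge (ltnW (ltnW lt)) /= gtn_eqF ?(ltnW lt) //.
    by case: ifP => _; lia.
  + rewrite !Sn_lt !Sn_eq !ltnn !eqxx /= (negbTE en).
    by case: b => //=; lia.
Qed.

(** Dual to [bar_comp_even]: the (n+1)-target of x is whiskered. *)
Lemma bar_comp_odd : odd n ->
  let V := tcomp n (bar_of Ny Zy) (whisker_table n Nx (trunc Zx n.+1 true)) in
  [/\ tcompat n (bar_of Ny Zy) (whisker_table n Nx (trunc Zx n.+1 true)),
      tcompat n.+1 V (bar_of Nx Zx) &
      tcomp n.+1 V (bar_of Nx Zx) = bar_of (tcomp n.+1 Ny Nx) (tcomp n Zy Zx)].
Proof.
move: cN cZ => [loN midN] [loZ midZ] on V; rewrite {}/V; split.
- split=> [j b s lt|s]; rewrite /whisker_table /bar_of /trunc.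
    by rewrite lt ltnS (ltnW lt) loZ // loN // ltnW.
  by rewrite ltnSn ltnn eqxx on /= midZ addnC loN.
- split=> [j b s lt|s]; rewrite /tcomp /whisker_table /bar_of /trunc.
    rewrite lt; case: (ltngtP j n) lt => [lt _|lt|-> _] //.
    + by rewrite ltnS leqNgt lt.
    + by rewrite on ltnn eqxx ltnSn /=; case: b; rewrite ?loN //= ?addn0 // addnC.
  by rewrite !Sn_lt !Sn_eq !ltnn !eqxx /= on /= midN; lia.
- apply: tableP => j b s; rewrite /tcomp /whisker_table /bar_of /trunc.
  case: (ltngtP j n.+1) => [lt|lt|->].
  + case: (ltngtP j n) lt => [//|lt|-> _]; first by rewrite ltnS leqNgt lt.
    by rewrite on; case: b.
  + rewrite ltnNge (ltnW (ltnW lt)) /= gtn_eqF ?(ltnW lt) //.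
    by case: ifP => _; lia.
  + rewrite !Sn_lt !Sn_eq !ltnn !eqxx /= on.
    by case: b => //=; lia.
Qed.

End BarComp.

(** * The lax coslice of a model *)

Section Coslice.
Variables (m : nat) (X : precat) (tb : X -> table).
Hypothesis mX : model m tb.
Implicit Types (c d p q : globe (X * X)) (a h x y z : X).

Definition top_chain x : chain := tb x (dim x) true.
Definition base_table c : table := globe_table (fun l : X * X => top_chain l.1) c.
(** The tables of the second components overlap, so only their top chains are
independent data; these form one table, whose level 0 is the object a.  The target
at level 0 is left empty, since in the cone it is the new vertex. *)
Definition bar_part a c : table := fun j b s =>
  if j is i.+1 then globe_table (fun l : X * X => top_chain l.2) c i b s
  else if b then 0 else tb a 0 true s.

(** The content of the conditions on a cell of the coslice, free of whiskerings. *)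
Definition label_ok a c := [/\ dim (base c) = gdim c, dim (bar c) = (gdim c).+1,
  tb (base c) = base_table c & tb (bar c) = bar_of (bar_part a c) (base_table c)].

Fixpoint coslice_ok a c : Prop :=
  label_ok a c /\
  if c is Arr p q _ then [/\ coslice_ok a p, coslice_ok a q & gparallel p q] else True.

Lemma coslice_ok_label a c : coslice_ok a c -> label_ok a c.
Proof. by case: c => [l|p q l] []. Qed.

Lemma coslice_ok_globular a c : coslice_ok a c -> globular c.
Proof. by elim: c => // p IHp q IHq l /= [_ [/IHp ? /IHq ? ?]]. Qed.

Lemma coslice_ok_side a b c : coslice_ok a c -> coslice_ok a (gside b c).
Proof. by case: b; case: c => // p q l /= [_ []]. Qed.

Lemma coslice_ok_bd a j b c : coslice_ok a c -> coslice_ok a (gbd c j b).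
Proof. by move=> h; rewrite gbdE; elim: (_ - _) => //= k; apply: coslice_ok_side. Qed.

Lemma base_table_bd c j b : globular c -> j <= gdim c ->
  base_table (gbd c j b) = trunc (base_table c) j b.
Proof. exact: globe_table_bd. Qed.

Lemma bar_part_bd a c j b : globular c -> j <= gdim c ->
  bar_part a (gbd c j b) = trunc (bar_part a c) j.+1 b.
Proof.
move=> wc le; apply: tableP => -[|i] e s //=.
by rewrite globe_table_bd // /trunc ltnS eqSS.
Qed.

Lemma bd_eq y x b : dim x = (dim y).+1 -> (bd b x = y) <-> (trunc (tb x) (dim y) b = tb y).
Proof.
move=> dx; have [|d t] := bdE mX b (x := x); first by rewrite dx.
rewrite -{1}[dim y]/(dim y).+1.-1 -dx -t; split=> [->//|e].
by apply: (tb_inj mX) => //; rewrite d dx.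
Qed.

(** Each step is one composition with the second component of a boundary of c, whose
table is known by hypothesis; this is what allows an induction on dimension. *)
Lemma whiskerE a c z i : globular c -> i <= gdim c -> i <= dim z ->
  (forall j b, j < i -> label_ok a (gbd c j b)) ->
  (forall j b s, j < i -> tb z j b s = base_table c j b s) ->
  dim (whisker i c z) = dim z /\ tb (whisker i c z) = whisker_table i (bar_part a c) (tb z).
Proof.
move=> wc; elim: i => [|i IH] lei lez ok ez.
  split=> //; apply: tableP => -[|j] b s; rewrite /whisker_table //=; lia.
have [||j b lt|j b s lt|dW tW] := IH; try exact: ltnW.
- by apply: ok; apply: ltnW.
- by apply: ez; apply: ltnW.
have [/= _ dB _ tB] := ok i (odd i) (ltnSn i).
rewrite gdim_bd // ?bar_part_bd ?base_table_bd // in dB tB; try exact: ltnW.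
have lt : i < maxn (dim z) i.+1 by rewrite leq_max ltnSn orbT.
have mx : maxn (dim z) i.+1 = dim z by apply/maxn_idPl.
rewrite /=; case: ifP dB tB => oi; rewrite /gbd => dB tB.
  have [cp <-] := whisker_table_odd oi tB ez.
  have [||dR tR] := wcompE mX (n := i) (y := bar (gtgtn i c)) (x := whisker i c z).
  - by rewrite dB dW maxnC.
  - by rewrite tW.
  - by rewrite dR tR dB dW tW maxnC.
have [cp <-] := whisker_table_even (negbT oi) tB ez.
have [||dR tR] := wcompE mX (n := i) (x := bar (gsrcn i c)) (y := whisker i c z).
- by rewrite dB dW.
- by rewrite tW.
- by rewrite dR tR dB dW tW.
Qed.

(** The two parities of the definition of coslice cells merged: the side on which the
second component is whiskered is the target in odd and the source in even
dimension n. *)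
Definition arr_cond a p q (l : X * X) :=
  let n := gdim p in let c := Arr p q l in
  [/\ dim l.1 = n.+1, src l.1 = base p & tgt l.1 = base q] /\
  [/\ dim l.2 = n.+2, bd (~~ odd n) l.2 = bar (gside (~~ odd n) c)
    & bd (odd n) l.2 = whisker n.+1 c l.1].

Lemma coslice_cellE a p q l : coslice_cell a (Arr p q l) <->
  [/\ coslice_cell a p, coslice_cell a q & gparallel p q] /\ arr_cond a p q l.
Proof.
case: l => x b; rewrite /arr_cond /=; case: (odd (gdim p)); rewrite /bd /gside /=.
  by split=> [[? [? [? []]]]|[? [? []]]].
by split=> [[? [? [? []]]]|[? [? []]]].
Qed.

(** Boundaries are determined by their tables, so prescribing source and target of a
cell of known top chain amounts to prescribing its table. *)
Lemma arr_label_ok a p q l : coslice_ok a p -> coslice_ok a q -> gparallel p q ->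
  arr_cond a p q l <-> label_ok a (Arr p q l).
Proof.
move=> okp okq par; set c := Arr p q l; set n := gdim p.
have wc : globular c by split=> //;
  [apply: coslice_ok_globular okp|apply: coslice_ok_globular okq].
have okside b : coslice_ok a (gside b c) by case: b.
have ds b : gdim (gside b c) = n by rewrite gdim_side.
have oklow j b : j < n.+1 -> label_ok a (gbd c j b).
  by move=> lt; rewrite gbd_step //; apply/coslice_ok_label/coslice_ok_bd/okside.
have bs b : base_table (gside b c) = trunc (base_table c) n b by apply: globe_table_side.
have Ns b : bar_part a (gside b c) =
  trunc (bar_part a c) n.+1 b by rewrite gside_bd // bar_part_bd.
(* The top level of both tables agrees by construction; the lower ones are
   determined by source and target. *)
have ebase (x : X) : dim x = n.+1 -> (forall s, top_chain x s = base_table c n.+1 true s) ->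
   (src x = base p /\ tgt x = base q) <-> tb x = base_table c.
  move=> dx tx; have E b : (bd b x = base (gside b c)) <->
    (trunc (tb x) n b = trunc (base_table c) n b).
    have [d _ <- _] := coslice_ok_label (okside b); rewrite ds in d.
    by rewrite bd_eq d // -bs; have [_ _ -> _] := coslice_ok_label (okside b).
  have -> : (src x = base p /\ tgt x = base q) <->
     (forall b, trunc (tb x) n b = trunc (base_table c) n b).
    split=> [[e1 e2] b|h]; first by apply/E; case: b.
    by split; [apply: (E false).2|apply: (E true).2].
  split=> [h|-> //]; apply: tableP => j b s; case: (ltngtP j n.+1) => [lt|lt|->].
  - have := congr1 (fun T : table => T j b s) (h b); rewrite /trunc.
    by move: lt; rewrite ltnS leq_eqVlt => /orP[/eqP->|->]; rewrite // ltnn eqxx.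
  - by rewrite (tb_hi mX) ?dx // /base_table globe_table_hi.
  - rewrite -{1}dx (tb_top mX x b true) -[LHS]/(top_chain x s) tx.
    by rewrite /base_table -[n.+1]/(gdim c) !globe_table_top.
have tl b s : top_chain l.1 s =
  base_table c n.+1 b s by rewrite /base_table -[n.+1]/(gdim c) globe_table_top.
have ebar : tb l.1 = base_table c -> dim l.1 = n.+1 -> dim l.2 = n.+2 ->
   (bd (~~ odd n) l.2 = bar (gside (~~ odd n) c) /\ bd (odd n) l.2 = whisker n.+1 c l.1) <->
   tb l.2 = bar_of (bar_part a c) (base_table c).
  move=> el d1 d2; set B := bar_of _ _.
  have [dW tW] := @whiskerE a c l.1 n.+1 wc (leqnn _) (eq_leq (esym d1)) oklow
     (fun j b s _ => congr1 (fun T : table => T j b s) el).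
  have {}tW : tb (whisker n.+1 c l.1) = trunc B n.+1 (odd n).
    rewrite tW el; apply: whisker_table_top => [b s|j b s lt]; first by rewrite -!tl.
    exact: globe_table_hi.
  have [_ dV _ tV] := coslice_ok_label (okside (~~ odd n)).
  have {}tV : tb (bar (gside (~~ odd n) c)) = trunc B n.+1 (~~ odd n).
    by rewrite tV Ns bs; apply: bar_trunc_keep.
  rewrite ds in dV; rewrite d1 in dW.
  rewrite !bd_eq ?dV ?dW // tV tW.
  split=> [[h1 h2]|-> //]; have {h1 h2} h b : trunc (tb l.2) n.+1 b = trunc B n.+1 b.
    by case: b; move: h1 h2; case: (odd n).
  apply: tableP => j b s; case: (ltngtP j n.+2) => [lt|lt|->].
  - have := congr1 (fun T : table => T j b s) (h b); rewrite /trunc.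
    by move: lt; rewrite ltnS leq_eqVlt => /orP[/eqP->|->]; rewrite // ltnn eqxx.
  - rewrite (tb_hi mX) ?d2 // /B /bar_of; case: j lt => // j lt.
    by rewrite /= /base_table !globe_table_hi ?if_same //=; lia.
  - rewrite -{1}d2 (tb_top mX l.2 b true) -[LHS]/(top_chain l.2 s) /B /bar_of /=.
    by rewrite /base_table [X in if _ then X else _]globe_table_hi // if_same addn0 -[n.+1]/(gdim c) globe_table_top.
split=> [[[d1 s1 t1] [d2 v w]]|[d1 d2 t1 t2]].
  have el : tb l.1 = base_table c by apply/(ebase l.1 d1) => // s; apply: tl.
  by split=> //; apply/ebar.
have [s1 s2] := (ebase l.1 d1 (tl true)).2 t1.
by have [v w] := (ebar t1 d1 d2).2 t2.
Qed.

Lemma pt_label_ok a l : dim a = 0 -> coslice_cell a (Pt l) <-> label_ok a (Pt l).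
Proof.
move=> da; case: l => x b /=; rewrite /label_ok /=.
have ex : dim x = 0 -> tb x = base_table (Pt (x, b)).
  move=> dx; apply: tableP => -[|j] e s; rewrite /base_table.
    have := globe_table_top (fun l : X * X => top_chain l.1) (Pt (x, b)) e s => /= ->.
    by rewrite /top_chain (tb_top mX x true e) dx.
  by rewrite globe_table_hi // (tb_hi mX) // dx.
have bx (y : X) e : dim b = 1 -> dim y = 0 ->
    (bd e b = y) <-> (forall s, tb b 0 e s = tb y 0 true s).
  move=> d1 dy; rewrite bd_eq dy //; split=> [h s|h].
    by rewrite -h truncE_eq.
  apply: tableP => -[|j] c s; rewrite /trunc /=; last by rewrite (tb_hi mX) // dy.
  by rewrite h -dy; apply: (tb_top mX).
set B := bar_of _ _; have B0 s : B 0 false s = tb a 0 true s by rewrite /B /bar_of addn0.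
have B1 : dim x = 0 -> forall s, B 0 true s = tb x 0 true s by move=> dx s;
  rewrite /B /bar_of /= ex.
have Bt e s : B 1 e s = top_chain b s.
  rewrite /B /bar_of /= /base_table [X in if _ then X else _]globe_table_hi // if_same addn0.
  exact: (globe_table_top (fun l : X * X => top_chain l.2) (Pt (x, b))).
have Bh j e s : 1 < j -> B j e s = 0.
  by case: j => // j lt; rewrite /B /bar_of /= /base_table !globe_table_hi ?if_same //=; lia.
split=> [[_ dx d1 sb tb']|[dx d1 tx tB]].
  have {}sb := (bx a false d1 da).1 sb; have {}tb' := (bx x true d1 dx).1 tb'.
  split=> //; first exact: ex.
  apply: tableP => -[|[|j]] e s; last by rewrite Bh // (tb_hi mX) // d1.
    by case: e; rewrite ?B0 ?B1 ?sb ?tb'.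
  by rewrite Bt /top_chain -{1}d1; apply: (tb_top mX).
split=> //; [apply: (bx a false d1 da).2|apply: (bx x true d1 dx).2] => s; rewrite tB.
  exact: B0.
exact: B1.
Qed.

(** By induction on the globe: once the tables of the boundaries are known,
[arr_label_ok] turns the conditions on the top label into equations of tables. *)
Lemma coslice_okP a c : dim a = 0 -> coslice_cell a c <-> coslice_ok a c.
Proof.
move=> da; elim: c => [l|p IHp q IHq l].
  by rewrite (pt_label_ok l da) /=; split=> [|[]].
rewrite coslice_cellE; split=> [[[/IHp okp /IHq okq par] /arr_label_ok h]|[h [okp okq par]]].
  by split=> //; apply: h.
by split; [split=> //; [apply/IHp|apply/IHq]|apply/arr_label_ok].
Qed.

Lemma coslice_dim0 a c : coslice_cell a c -> dim a = 0.
Proof. by elim: c => [[x b] []|p IHp q IHq [x b] [[/IHp]]]. Qed.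

Lemma coslice_cell_ok a c : coslice_cell a c -> coslice_ok a c.
Proof. by move=> h; apply/coslice_okP => //; apply: coslice_dim0 h. Qed.

Lemma coslice_inj a c d : coslice_ok a c -> coslice_ok a d -> gdim c = gdim d ->
  base_table c = base_table d -> bar_part a c = bar_part a d -> c = d.
Proof.
move=> okc okd e eb en; have wc := coslice_ok_globular okc; have wd := coslice_ok_globular okd.
apply: globe_ext => // j b le.
have := coslice_ok_label (coslice_ok_bd j b okc).
have := coslice_ok_label (coslice_ok_bd j b okd).
rewrite /label_ok !base_table_bd -?e // !bar_part_bd -?e // eb en !gdim_bd -?e //.
move=> [d1 d2 t1 t2] [d1' d2' t1' t2'].
rewrite [LHS]surjective_pairing [RHS]surjective_pairing; congr (_, _).
  by apply: (tb_inj mX); [rewrite [LHS]d1' [RHS]d1|rewrite [LHS]t1' [RHS]t1].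
by apply: (tb_inj mX); [rewrite [LHS]d2' [RHS]d2|rewrite [LHS]t2' [RHS]t2].
Qed.

End Coslice.

(** * Cone tables, composition and action in the coslice *)

Section Join.
Variable m : nat.

(** The inverse of splitting at the apex: N is the part avoiding m and Z the link, so
that level 0 of the target is the vertex m.  The default m.+1 of [last] keeps the
empty sequence in the first part. *)
Definition cone_join (N Z : table) : table := fun j b s =>
  if last m.+1 s == m then
    (if j is i.+1 then Z i b (take (size s).-1 s) else nat_of_bool (b && (s == [:: m])))
  else N j b s.

(** Guarantees that N does not interfere with the simplices ending in m. *)
Definition supported (N : table) := forall j b s, N j b s <> 0 -> is_simplex m s.

Lemma supported_apex N j b s : supported N -> last m.+1 s == m -> N j b s = 0.
Proof.
move=> lN; case: (N j b s =P 0) => // /lN/apex_notin; case: (lastP s) => [|t v] /=.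
  by rewrite gtn_eqF.
by rewrite last_rcons => nv /eqP e; rewrite -e mem_rcons mem_head in nv.
Qed.

Lemma join_rcons N Z j b s : cone_join N Z j.+1 b (rcons s m) = Z j b s.
Proof. by rewrite /cone_join last_rcons eqxx size_rcons -cats1 take_size_cat. Qed.

Lemma link_join N Z : link m (cone_join N Z) = Z.
Proof. by apply: tableP => j b s; apply: join_rcons. Qed.

Lemma last_apex s : last m.+1 s == m -> exists t, s = rcons t m.
Proof.
case: (lastP s) => [|t v] /=; first by rewrite gtn_eqF.
by rewrite last_rcons => /eqP->; exists t.
Qed.

Lemma off_apex_join N Z : supported N -> off_apex m (cone_join N Z) = N.
Proof.
move=> lN; apply: tableP => j b s; rewrite /off_apex /cone_join.
case: ifP => [ms|ns]; last first.
  by case: ifP => // /last_apex[t e]; rewrite e mem_rcons mem_head in ns.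
by case: (N j b s =P 0) => // /lN/apex_notin; rewrite ms.
Qed.

Lemma join_decomp T : (forall j b s, T j b s <> 0 -> is_simplex m.+1 s /\ size s = j.+1) ->
  is_leg m T -> T = cone_join (off_apex m T) (link m T).
Proof.
move=> supp [l0 l1]; apply: tableP => j b s; rewrite /cone_join.
case: ifP => [/last_apex[t ->]|nl].
  case: j => [|j]; last by rewrite size_rcons -cats1 take_size_cat // cats1.
  case: eqP => [->|ne]; first by rewrite andbT; case: b.
  rewrite andbF; case: (T 0 b (rcons t m) =P 0) => // /supp[_]; rewrite size_rcons => -[] /eqP.
  by rewrite size_eq0 => /eqP e; rewrite e in ne.
rewrite /off_apex; case: ifP => // ms;
  case: (T j b s =P 0) => // /supp[/is_simplexP[gs _ _|t _ e _]].
  by have := apex_notin gs; rewrite ms.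
by rewrite e last_rcons eqxx in nl.
Qed.

Lemma trunc_join N Z k b : trunc (cone_join N Z) k.+1 b =
  cone_join (trunc N k.+1 b) (trunc Z k b).
Proof.
apply: tableP => -[|j] c s; rewrite /cone_join /trunc; first by case: ifP.
by rewrite ltnS eqSS; case: (last _ _ == _); case: (j < k); case: (j == k).
Qed.

Lemma tcomp_join n Ny Nx Zy Zx :
  tcomp n.+1 (cone_join Ny Zy) (cone_join Nx Zx) = cone_join (tcomp n.+1 Ny Nx) (tcomp n Zy Zx).
Proof.
apply: tableP => -[|j] b s; rewrite /cone_join /tcomp; first by case: ifP.
rewrite ltnS eqSS; case: (last _ _ == _); case: (j < n) => //; case: eqP => // ->; by case: b.
Qed.

Lemma tcompat_join n Ny Nx Zy Zx : supported Ny -> supported Nx ->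
  tcompat n.+1 (cone_join Ny Zy) (cone_join Nx Zx) -> tcompat n.+1 Ny Nx /\ tcompat n Zy Zx.
Proof.
move=> lNy lNx [lo mid]; split; split=> [j b s lt|s].
- case l: (last m.+1 s == m); first by rewrite !supported_apex.
  by have := lo j b s lt; rewrite /cone_join l.
- case l: (last m.+1 s == m); first by rewrite !supported_apex.
  by have := mid s; rewrite /cone_join l.
- by have := lo j.+1 b (rcons s m) lt; rewrite !join_rcons.
- by have := mid (rcons s m); rewrite !join_rcons.
Qed.

Lemma tcomp_join0 N Z H : supported H ->
  tcomp 0 (cone_join N Z) H = cone_join (tcomp 0 N H) Z.
Proof.
move=> lH; apply: tableP => j b s; rewrite /cone_join /tcomp /=.
case l: (last m.+1 s == m); last by case: j => [|j].
case: j => [|j] /=; last by rewrite (supported_apex _ _ lH l) addn0.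
by case: b => //; rewrite (supported_apex _ _ lH l).
Qed.

End Join.

Section CosliceComp.
Variables (m : nat) (X : precat) (tb : X -> table).
Hypothesis mX : model m tb.
Implicit Types (c d e x y : globe (X * X)) (a h : X).
Local Notation base_table := (base_table tb).
Local Notation bar_part := (bar_part tb).
Local Notation coslice_ok := (coslice_ok tb).
Local Notation label_ok := (label_ok tb).

(** Both sides have the same table by [bar_comp_even] or [bar_comp_odd]; the verification
of composability at each step is part of those lemmas. *)
Lemma comp_label a n e y x : label_ok a e -> label_ok a y -> coslice_ok a x ->
  gdim e = gdim x -> gdim y = gdim x -> n < gdim x ->
  tcompat n.+1 (bar_part a y) (bar_part a x) -> tcompat n (base_table y) (base_table x) ->
  bar_part a e = tcomp n.+1 (bar_part a y) (bar_part a x) ->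
  base_table e = tcomp n (base_table y) (base_table x) ->
  label e = @coslice_label X n y x.
Proof.
move=> [de de' te te'] [dy dy' ty ty'] okx ex yx lt cN cZ eN eZ.
have [dx dx' tx tx'] := coslice_ok_label okx; have wx := coslice_ok_globular okx.
have oklow j b : j < n -> label_ok a (gbd x j b).
  by move=> _; apply/coslice_ok_label/coslice_ok_bd.
rewrite [LHS]surjective_pairing /coslice_label; congr (_, _).
  have hc : composable n (base y) (base x).
    by apply/(composableE mX); rewrite dy dx ty tx yx.
  have [d t] := md_comp mX hc; apply: (tb_inj mX).
    by rewrite d dx [LHS]de ex.
  by rewrite t ty tx [LHS]te eZ.
case: ifP => on.
  have -> : tgtn n.+1 (base x) = bdn n.+1 true (base x) by [].
  have [hz tz] := bdnE mX true (j := n.+1) (x := base x) (eq_ind_r (fun k => n < k) lt dx).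
  have [C1 C2 C3] := bar_comp_odd cN cZ on.
  have [|||j b s ltj|dW tW] := whiskerE mX (a := a) (c := x) (z := bdn n.+1 true (base x)) (i := n) wx.
  - exact: ltnW.
  - by rewrite hz.
  - by move=> j b ltj; apply: oklow.
  - by rewrite tz tx truncE_lt // ltnW.
  rewrite hz tz tx in dW tW.
  have [||d1 t1] := wcompE mX (n := n) (y := bar y) (x := whisker n x (bdn n.+1 true (base x))).
  - by rewrite dW dy' leq_max ltnSn orbT.
  - by rewrite tW ty'.
  rewrite dW dy' yx tW ty' in d1 t1.
  have [||d2 t2] := wcompE mX (n := n.+1)
      (y := wcomp n (bar y) (whisker n x (bdn n.+1 true (base x)))) (x := bar x).
  - by rewrite d1 dx'; lia.
  - by rewrite t1 tx'.
  apply: (tb_inj mX); first by rewrite [LHS]de' d2 d1 dx'; lia.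
  by rewrite [LHS]te' t2 t1 tx' C3 eN eZ.
have {}on : ~~ odd n by rewrite on.
have -> : srcn n.+1 (base y) = bdn n.+1 false (base y) by [].
have [|hz tz] := bdnE mX false (j := n.+1) (x := base y); first by rewrite dy yx.
have [C1 C2 C3] := bar_comp_even cN cZ on.
have [|||j b s ltj|dW tW] := whiskerE mX (a := a) (c := x) (z := bdn n.+1 false (base y)) (i := n) wx.
- exact: ltnW.
- by rewrite hz.
- by move=> j b ltj; apply: oklow.
- by rewrite tz ty truncE_lt ?(cZ.1) // ltnW.
rewrite hz tz ty in dW tW.
have [||d1 t1] := wcompE mX (n := n) (y := whisker n x (bdn n.+1 false (base y))) (x := bar x).
- by rewrite dW dx' leq_max ltnSn.
- by rewrite tW tx'.
rewrite dW dx' tW tx' in d1 t1.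
have [||d2 t2] := wcompE mX (n := n.+1)
    (x := wcomp n (whisker n x (bdn n.+1 false (base y))) (bar x)) (y := bar y).
- by rewrite d1 dy'; lia.
- by rewrite t1 ty'.
apply: (tb_inj mX); first by rewrite [LHS]de' d2 d1 dy'; lia.
by rewrite [LHS]te' t2 t1 ty' C3 eN eZ.
Qed.

(** Applied to a cell e obtained by [coslice_surj], this proves that coslices are closed
under composition. *)
Lemma coslice_gcomp a n e y x : coslice_ok a e -> coslice_ok a y -> coslice_ok a x ->
  gdim e = gdim x -> gdim y = gdim x -> n < gdim x ->
  tcompat n.+1 (bar_part a y) (bar_part a x) -> tcompat n (base_table y) (base_table x) ->
  bar_part a e = tcomp n.+1 (bar_part a y) (bar_part a x) ->
  base_table e = tcomp n (base_table y) (base_table x) ->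
  gcomp (@coslice_label X) n y x = e.
Proof.
move=> oke oky okx ex yx lt cN cZ eN eZ.
have we := coslice_ok_globular oke; have wy := coslice_ok_globular oky;
  have wx := coslice_ok_globular okx.
have le := ltnW lt.
apply: gcomp_eq => //.
- apply: (coslice_inj mX (a := a)); try exact: coslice_ok_bd.
  + by rewrite !gdim_bd ?ex.
  + by rewrite !base_table_bd ?ex // eZ trunc_tcomp_src.
  + by rewrite !bar_part_bd ?ex // eN trunc_tcomp_src.
- apply: (coslice_inj mX (a := a)); try exact: coslice_ok_bd.
  + by rewrite !gdim_bd ?ex ?yx.
  + by rewrite !base_table_bd ?ex ?yx // eZ trunc_tcomp_tgt.
  + by rewrite !bar_part_bd ?ex ?yx // eN trunc_tcomp_tgt.
- move=> j b /andP[ltj lej]; apply: (comp_label (a := a)).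
  + exact/coslice_ok_label/coslice_ok_bd.
  + exact/coslice_ok_label/coslice_ok_bd.
  + exact: coslice_ok_bd.
  + by rewrite !gdim_bd ?ex.
  + by rewrite !gdim_bd ?yx.
  + by rewrite !gdim_bd.
  + by rewrite !bar_part_bd ?yx //; apply: tcompat_trunc.
  + by rewrite !base_table_bd ?yx //; apply: tcompat_trunc.
  + by rewrite !bar_part_bd ?ex ?yx // eN trunc_tcomp.
  + by rewrite !base_table_bd ?ex ?yx // eZ trunc_tcomp.
Qed.

Lemma bar_of_tcomp0 N Z H :
  bar_of (tcomp 0 N H) Z = tcomp 0 (bar_of N Z) H.
Proof.
apply: tableP => -[|j] b s; rewrite /bar_of /tcomp /=; last by rewrite addnAC.
by case: b; rewrite ?addn0.
Qed.

Lemma action_label a a' c h e : label_ok a' e -> label_ok a c ->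
  gdim e = gdim c -> dim h = (gdim c).+1 ->
  (forall s, tb h 0 true s = tb a 0 true s) ->
  bar_part a' e = tcomp 0 (bar_part a c) (tb h) -> base_table e = base_table c ->
  label e = (base c, comp 0 (bar c) h).
Proof.
move=> [de de' te te'] [dc dc' tc tc'] ed dh ht eN eZ.
rewrite [LHS]surjective_pairing; congr (_, _).
  by apply: (tb_inj mX); [rewrite [LHS]de dc|rewrite [LHS]te tc].
have hc : composable 0 (bar c) h.
  apply/(composableE mX); rewrite dc' dh; split=> //; split=> // s.
  by rewrite ht tc' /bar_of addn0.
have [d t] := md_comp mX hc; apply: (tb_inj mX); first by rewrite d dh -ed [LHS]de'.
by rewrite t tc' [LHS]te' eN eZ bar_of_tcomp0.
Qed.

(** The analogue of [coslice_gcomp] for the right action: it shows that the action maps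
cells to cells. *)
Lemma action_eq a a' c h e : coslice_ok a' e -> coslice_ok a c ->
  gdim e = gdim c -> dim h = (gdim c).+1 ->
  (forall s, tb h 0 true s = tb a 0 true s) ->
  bar_part a' e = tcomp 0 (bar_part a c) (tb h) -> base_table e = base_table c ->
  action c h = e.
Proof.
elim: c e h => [l|p IHp q IHq l] [l'|p' q' l'] h // oke okc ed dh ht eN eZ.
  have := action_label (coslice_ok_label oke) (coslice_ok_label okc) ed dh ht eN eZ.
  by case: l {okc eN eZ ed dh} => x b /= ->.
have := action_label (coslice_ok_label oke) (coslice_ok_label okc) ed dh ht eN eZ.
have wc := coslice_ok_globular okc; have we := coslice_ok_globular oke.
have S (b : bool) : [/\
  dim (bd b h) = (gdim p).+1, (forall s, tb (bd b h) 0 true s = tb a 0 true s),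
    bar_part a' (gside b (Arr p' q' l')) =
      tcomp 0 (bar_part a (gside b (Arr p q l))) (tb (bd b h))
    & base_table (gside b (Arr p' q' l')) = base_table (gside b (Arr p q l))].
  have [|d t] := bdE mX b (x := h); first by rewrite dh.
  have [ed'] := ed; rewrite !gside_bd //= !base_table_bd ?bar_part_bd //= ?ed' // eZ eN.
  by rewrite d t dh trunc_tcomp //=; split=> // s; rewrite truncE_lt.
have [d1 h1 n1 z1] := S false; have [d2 h2 n2 z2] := S true.
have [_ [okp okq [epq _]]] := okc; have [_ [okp' okq' [epq' _]]] := oke.
have [ed'] := ed.
have Ep : action p (src h) = p' by apply: IHp.
have Eq : action q (tgt h) = q' by apply: IHq; rewrite // -?epq -?epq'.
by case: l {okc oke wc we eN eZ S n1 n2 z1 z2 ed dh} => x b /= ->; rewrite Ep Eq.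
Qed.

Lemma bar_part_supported a c : supported m (bar_part a c).
Proof.
move=> [|j] b s /=; first by case: b => // /(steiner_supp (tb_valid mX a))[].
by rewrite /globe_table; case: ifP => // _ /(steiner_supp (tb_valid mX _))[].
Qed.

(** This is [steiner_leg], the two components of c having Steiner tables as cells of X. *)
Lemma leg_steiner a c : dim a = 0 -> coslice_ok a c ->
  steiner m.+1 (gdim c).+1 (cone_join m (bar_part a c) (base_table c)) /\
  is_leg m (cone_join m (bar_part a c) (base_table c)).
Proof.
move=> da okc; have wc := coslice_ok_globular okc.
have [db dr tb_b tb_r] := coslice_ok_label okc.
have leg : is_leg m (cone_join m (bar_part a c) (base_table c)).
  by rewrite /is_leg /cone_join /= !eqxx.
have bs j b s : base_table c j b s <> 0 -> is_simplex m s /\ size s = j.+1.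
  rewrite -tb_b; exact: (steiner_supp (tb_valid mX _)).
have ns j b s : bar_part a c j b s <> 0 -> is_simplex m s /\ size s = j.+1.
  case: j => [|j] /=; first by case: b => // /(steiner_supp (tb_valid mX a)).
  rewrite /globe_table; case: ifP => // le.
  have [_ d _ _] := coslice_ok_label (coslice_ok_bd j b okc).
  by rewrite gdim_bd // in d; rewrite /top_chain [dim _]d => /(steiner_supp (tb_valid mX _)).
split=> //; apply: steiner_leg => //.
- move=> j b s; rewrite /cone_join; case: ifP => [/last_apex[t ->]|_].
    rewrite is_simplex_rcons !size_rcons; case: j => [|j].
      by case: eqP => [|_]; rewrite ?andbF //; case: t => // u t /(congr1 size);
        rewrite size_rcons.
    by rewrite -cats1 take_size_cat // => /bs[? ->].
  by move=> /ns[/is_simplexW].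
- by move=> v lt; rewrite /cone_join /= ltn_eqF.
- by move=> s; rewrite /cone_join /base_table /bar_part !globe_table_top.
- move=> j b s lt; rewrite /cone_join; case: j lt => // j lt.
  by rewrite /bar_part /base_table !globe_table_hi // if_same.
- by rewrite link_join -tb_b -db; apply: (tb_valid mX).
- by rewrite /bar_table link_join off_apex_join -?tb_r -?dr;
  [apply: (tb_valid mX)|apply: bar_part_supported].
Qed.

End CosliceComp.

(** * The cone of a model *)

Section Surj.
Variables (m : nat) (X : precat) (tb : X -> table).
Hypothesis mX : model m tb.
Local Notation base_table := (base_table tb).
Local Notation bar_part := (bar_part tb).

(** Splitting the truncations of T gives the tables of both components in all
dimensions; cells of X with these tables are the labels of a globe. *)
Lemma coslice_surj k T : steiner m.+1 k.+1 T -> is_leg m T ->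
  (forall v, v < m -> T 0 true [:: v] = 0) ->
  exists a c, [/\ coslice_cell a c, gdim c = k & cone_join m (bar_part a c) (base_table c) = T].
Proof.
move=> sT leg t0; have supp := steiner_supp sT.
have sX := steiner_link leg sT; have sB := steiner_bar leg sT.
have [a [da ta]] := md_surj mX (steiner_trunc 0 false sB).
have restt j b : off_apex m (trunc T j.+1 b) = trunc (off_apex m T) j.+1 b.
  apply: tableP => i c s; rewrite /off_apex /trunc; case: (m \in s) => //.
  by rewrite !if_same.
have apext j b : link m (trunc T j.+1 b) = trunc (link m T) j b.
  by apply: tableP => i c s; rewrite /link /trunc ltnS eqSS.
have legt j b : is_leg m (trunc T j.+1 b) by rewrite /is_leg !truncE_lt.
(* Both sides of each level are chosen at once, to be shared by all globes built
   from them. *)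
have /choice[S Sok] : forall jb : nat * bool, exists l : X * X,
    [/\ dim l.1 = jb.1, dim l.2 = jb.1.+1, tb l.1 = trunc (link m T) jb.1 jb.2 &
        tb l.2 = bar_table m (trunc T jb.1.+1 jb.2)].
  move=> [j b] /=.
  have [x [dx tx]] := md_surj mX (steiner_trunc j b sX).
  have [y [dy ty]] := md_surj mX (steiner_bar (legt j b) (steiner_trunc j.+1 b sT)).
  by exists (x, y).
pose G := mkglobe (fun j b => S (j, b)).
have top1 j b s : top_chain tb (S (j, b)).1 s = link m T j b s.
  by have [/= d1 _ t1 _] := Sok (j, b); rewrite /top_chain d1 t1 truncE_eq.
have top2 j b s : top_chain tb (S (j, b)).2 s = off_apex m T j.+1 b s.
  have [/= _ d2 _ t2] := Sok (j, b); rewrite /top_chain d2 t2 /bar_table /bar_of restt apext.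
  by rewrite truncE_eq /trunc ltnNge leqnSn /= gtn_eqF // if_same addn0.
have Gb j b : base_table (G j b) = trunc (link m T) j b.
  by apply: tableP => i c s; rewrite /base_table globe_table_mk /trunc !top1.
(* The 0-target is the vertex m alone. *)
have r0 s : off_apex m T 0 true s = 0.
  case: (off_apex m T 0 true s =P 0) => // /[dup] nz /(off_apex_supp supp)[/andP[_ al]].
  case: s al nz => [|v [|]] //= /andP[lt _] + _; rewrite /off_apex t0 //.
  by rewrite if_same.
have a0 s : tb a 0 true s = off_apex m T 0 false s.
  by rewrite ta truncE_eq /bar_table /bar_of addn0.
have Gr j b : bar_part a (G j b) = trunc (off_apex m T) j.+1 b.
  apply: tableP => -[|i] c s.
    by rewrite truncE_lt //= a0; case: c; rewrite ?r0.
  by rewrite /bar_part globe_table_mk /trunc ltnS eqSS !top2.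
have Gok j b : coslice_ok tb a (G j b).
  have lab i c : label_ok tb a (G i c).
    have [/= d1 d2 t1 t2] := Sok (i, c).
    rewrite /label_ok /base /bar label_mk gdim_mk Gb Gr; split=> //.
    by rewrite t2 /bar_table restt apext.
  elim: j b => [|j IH] b; first by split=> //; apply: lab 0 b.
  split; first exact: (lab j.+1 b).
  split; [exact: (IH false)|exact: (IH true)|exact: mkglobe_par].
exists a, (G k true); split; [|exact: gdim_mk|].
  by apply/(coslice_okP mX).
rewrite Gr Gb -(trunc_join m) -(join_decomp supp leg).
exact: trunc_id sT.
Qed.

End Surj.

Section Cone.
Variables (m : nat) (X : precat) (tb : X -> table).
Hypothesis mX : model m tb.
Local Notation base_table := (base_table tb).
Local Notation bar_part := (bar_part tb).

(** A cell from an old object to the new one has as table the cone over its first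
component together with its second component. *)
Definition cone_table (u : cone X) : table :=
  match u with
  | Old x => tb x
  | Leg a c => cone_join m (bar_part a (sval c)) (base_table (sval c))
  | Apex _ => apex_table m
  end.

Lemma Leg_eq (a : X) (c d : coslice a) : sval c = sval d -> Leg c = Leg d :> cone X.
Proof. by move=> e; congr Leg; apply: sval_inj. Qed.

Lemma tb_supported x : supported m (tb x).
Proof. by move=> j b s /(steiner_supp (tb_valid mX x))[]. Qed.

Lemma old_apex x j b : tb x j b [:: m] = 0.
Proof.
case: (tb x j b [:: m] =P 0) => // /(steiner_supp (tb_valid mX x))[/apex_notin].
by rewrite mem_head.
Qed.

Lemma join_apex N Z b : cone_join m N Z 0 b [:: m] = b.
Proof. by rewrite /cone_join /= !eqxx andbT. Qed.

Lemma Leg_ext (a b : X) (c : coslice a) (d : coslice b) : dim c = dim d ->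
  cone_table (Leg c) = cone_table (Leg d) -> Leg c = Leg d :> cone X.
Proof.
move=> e et; have okc := coslice_cell_ok mX (svalP c); have okd := coslice_cell_ok mX (svalP d).
have eN : bar_part a (sval c) = bar_part b (sval d).
  by have := congr1 (off_apex m) et; rewrite /= !off_apex_join //;
    apply: bar_part_supported mX _ _.
have eZ : base_table (sval c) = base_table (sval d).
  by have := congr1 (link m) et; rewrite /= !link_join.
have ab : a = b.
  apply: (dim0_ext mX); [exact: coslice_dim0 (svalP c)|exact: coslice_dim0 (svalP d)|].
  by move=> s; exact: (congr1 (fun T : table => T 0 false s) eN).
subst b; apply: Leg_eq; exact: (coslice_inj mX okc okd).
Qed.

Lemma coslice_side (a : X) (c : coslice a) b : coslice_cell a (gside b (sval c)).
Proof.
apply/(coslice_okP mX); first exact: coslice_dim0 (svalP c).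
exact/coslice_ok_side/(coslice_cell_ok mX (svalP c)).
Qed.

Lemma cone_tabulated : tabulated m.+1 cone_table.
Proof.
split.
- case=> [x|a c|k] /=; [exact/steinerW/(tb_valid mX)| |exact: steiner_apex].
  have [] // := leg_steiner mX (coslice_dim0 (svalP c)) (coslice_cell_ok mX (svalP c)).
- case=> [x|a c|k] [y|b d|l] /= e et.
  + by congr Old; apply: (tb_inj mX).
  + by have := congr1 (fun T : table => T 0 true [:: m]) et; rewrite old_apex join_apex.
  + by have := congr1 (fun T : table => T 0 true [:: m]) et; rewrite old_apex /apex_table !eqxx.
  + by have := congr1 (fun T : table => T 0 true [:: m]) et; rewrite old_apex join_apex.
  + by apply: Leg_ext => //; case: e.
  + by have := congr1 (fun T : table => T 0 false [:: m]) et;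
    rewrite join_apex /apex_table !eqxx.
  + by have := congr1 (fun T : table => T 0 true [:: m]) et; rewrite old_apex /apex_table !eqxx.
  + by have := congr1 (fun T : table => T 0 false [:: m]) et;
    rewrite join_apex /apex_table !eqxx.
  + by rewrite e.
- move=> b [x|a c|k] /= lt.
  + by have := bdE mX b lt; case: b.
  + have okc := coslice_cell_ok mX (svalP c); have wc := coslice_ok_globular okc.
    have -> : bd b (Leg c : cone X) = if dim c == 0 then (if b then Apex X 0 else Old a)
      else Leg (bd b c) by case: b => /=; case: ifP.
    case: eqP => [c0|/eqP]; last first.
      rewrite -lt0n => c0; have e : sval (bd b c) = gside b (sval c).
        by case: b; apply: clampE; [apply: (coslice_side c true)|apply: (coslice_side c false)].
      split; first by rewrite /= -[LHS]/(gdim (sval (bd b c))).+1 e gdim_side // prednK.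
      rewrite /= e gside_bd // base_table_bd ?bar_part_bd ?leq_pred // -trunc_join.
      by rewrite prednK.
    have da := coslice_dim0 (svalP c).
    have {}c0 : gdim (sval c) = 0 := c0.
    case: b => /=; rewrite ?da c0; split=> //; apply: tableP => -[|j] e s; rewrite /trunc //=.
    * rewrite /apex_table /cone_join /=; case: ifP => // nl; case: (s =P [:: m]) => // es.
      by rewrite es /= eqxx in nl.
    * rewrite /cone_join /=; case: ifP => [l|_]; last by rewrite -da; apply: (tb_top mX).
      by apply: supported_apex l => j' b' s' /(steiner_supp (tb_valid mX a))[].
    * by rewrite (tb_hi mX) // da.
  + by case: b => /=; rewrite (trunc_id _ (steiner_apex m k.-1)).
Qed.

(** The object a is determined by the table, so a cell with prescribed table can be
found in the coslice at a given object. *)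
Lemma coslice_at (a : X) k N Z : dim a = 0 -> supported m N ->
  (forall s, N 0 false s = tb a 0 true s) -> (forall s, N 0 true s = 0) ->
  steiner m.+1 k.+1 (cone_join m N Z) ->
  exists c, [/\ coslice_cell a c, gdim c = k, bar_part a c = N & base_table c = Z].
Proof.
move=> da lN N0 N1 st.
have [||a' [c [oc dc ec]]] := coslice_surj mX st.
- by rewrite /is_leg !join_apex.
- by move=> v lt; rewrite /cone_join /= ltn_eqF // N1.
have eN : bar_part a' c = N.
  by rewrite -(off_apex_join Z lN) -ec off_apex_join //; apply: bar_part_supported mX _ _.
have ea : a' = a.
  apply: (dim0_ext mX) => //; first exact: coslice_dim0 oc.
  by move=> s; rewrite -N0 -eN.
exists c; rewrite -ea; split=> //.
by rewrite -(link_join m N Z) -ec link_join.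
Qed.

Lemma cone_comp_action (b : X) (d : coslice b) (x : X) :
  dim (Leg d : cone X) = dim x -> 0 < dim x ->
  tcompat 0 (cone_table (Leg d)) (tb x) ->
  dim (comp 0 (Leg d : cone X) (Old x)) = dim x /\
  cone_table (comp 0 (Leg d : cone X) (Old x)) = tcomp 0 (cone_table (Leg d)) (tb x).
Proof.
move=> ed lt cp; have okd := coslice_cell_ok mX (svalP d).
(* The acting cell x leads from its 0-source to b, so the result lies in the
   coslice at that 0-source. *)
have [dz tz] := bdnE mX false (leq0n (dim x)).
have ht s : tb x 0 true s = tb b 0 true s.
  have := cp.2 s; rewrite /= /cone_join; case: ifP => // l _.
  by rewrite (supported_apex 0 true (@tb_supported x) l) (supported_apex 0 true (@tb_supported b) l).
have st : steiner m.+1 (gdim (sval d)).+1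
    (cone_join m (tcomp 0 (bar_part b (sval d)) (tb x)) (base_table (sval d))).
  rewrite -tcomp_join0; last exact: tb_supported.
  apply: steiner_tcomp => //; first exact: (tb_valid cone_tabulated (Leg d)).
  by have := tb_valid cone_tabulated (Old x); rewrite /= -ed.
have [|s|s|c [oc dc eN eZ]] := coslice_at (a := srcn 0 x) dz _ _ _ st.
- move=> [|j] f s; first by case: f => //=; apply: tb_supported.
  rewrite /tcomp /=; case: (tb x j.+1 f s =P 0) => [->|/tb_supported //].
  by rewrite addn0; apply: (@bar_part_supported _ _ _ mX b (sval d) j.+1 f s).
- by rewrite -[srcn 0 x]/(bdn 0 false x) tz truncE_eq.
- by [].
have act : action (sval d) x = c.
  apply: (action_eq mX (a := b) (a' := srcn 0 x)) => //.
  exact: (coslice_cell_ok mX oc).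
have -> : comp 0 (Leg d : cone X) (Old x) = Leg (exist _ c oc : coslice (srcn 0 x)).
  rewrite /=; case: pselect => [e|]; last by rewrite act.
  by apply: Leg_eq.
by rewrite /= eN eZ dc tcomp_join0 //; apply: tb_supported.
Qed.

Lemma cone_comp_leg (a b : X) (c : coslice a) (d : coslice b) n :
  dim (Leg d : cone X) = dim (Leg c : cone X) -> n.+1 < dim (Leg c : cone X) ->
  tcompat n.+1 (cone_table (Leg d)) (cone_table (Leg c)) ->
  dim (comp n.+1 (Leg d : cone X) (Leg c)) = dim (Leg c : cone X) /\
  cone_table (comp n.+1 (Leg d : cone X) (Leg c)) =
    tcomp n.+1 (cone_table (Leg d)) (cone_table (Leg c)).
Proof.
move=> ed lt cp; have okd := coslice_cell_ok mX (svalP d).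
have okc := coslice_cell_ok mX (svalP c).
have [cN cZ] := tcompat_join (bar_part_supported mX (a := b) (c := sval d))
   (bar_part_supported mX (a := a) (c := sval c)) cp.
have da := coslice_dim0 (svalP c); have db := coslice_dim0 (svalP d).
have ab : b = a.
  by apply: (dim0_ext mX) => // s; have := cN.1 0 false s isT.
subst b.
have st : steiner m.+1 (gdim (sval c)).+1
    (cone_join m (tcomp n.+1 (bar_part a (sval d)) (bar_part a (sval c)))
            (tcomp n (base_table (sval d)) (base_table (sval c)))).
  rewrite -tcomp_join; apply: steiner_tcomp => //.
    by have := tb_valid cone_tabulated (Leg d); rewrite ed.
  exact: (tb_valid cone_tabulated (Leg c)).
have [|||e [oe de eN eZ]] := coslice_at da _ _ _ st.
- move=> j f s; rewrite /tcomp; case: ifP => _; first exact: (bar_part_supported mX).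
  case: ifP => _; first by case: f; apply: (bar_part_supported mX).
  case: (bar_part a (sval c) j f s =P 0) => [->|/(bar_part_supported mX) //].
  by rewrite addn0; apply: (bar_part_supported mX).
- by [].
- by [].
have oke := coslice_cell_ok mX oe.
case: ed => ed.
have gc : gcomp (@coslice_label X) n (sval d) (sval c) = e.
  by apply: (coslice_gcomp mX (a := a)).
have -> : comp n.+1 (Leg d : cone X) (Leg c) = Leg (exist _ e oe : coslice a).
  rewrite /=; case: pselect => // e'; rewrite (Prop_irrelevance e' erefl) /=.
  by apply: Leg_eq; rewrite -[RHS]gc; apply: clampE; rewrite gc.
by rewrite /= eN eZ de tcomp_join.
Qed.

(** Composable pairs of mixed kinds are excluded by the coefficients at the new vertex
of the chains of level 0, except for the action of X and for the composition with
identities of the new object. *)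
Theorem cone_model : model m.+1 cone_table.
Proof.
have tab := cone_tabulated; split=> //.
- move=> k T sT; case: (steinerP sT) => [sT'|k' ek leg t0|->].
  + by have [x [dx tx]] := md_surj mX sT'; exists (Old x).
  + subst k; have [a [c [oc dc tc]]] := coslice_surj mX sT leg t0.
    by exists (Leg (exist _ c oc : coslice a)); rewrite /= dc tc.
  + by exists (Apex X k).
- move=> [x|a c|k]; [exact: (md_idc mX x)| |by []].
  have okc := coslice_cell_ok mX (svalP c); have da := coslice_dim0 (svalP c).
  have wc := coslice_ok_globular okc.
  have [db dr t1 t2] := coslice_ok_label okc.
  have z (x : X) s : top_chain tb (idc x) s = 0.
    by have [d t] := md_idc mX x; rewrite /top_chain d t (tb_hi mX).
  pose c' := Arr (sval c) (sval c) (idc (label (sval c)).1, idc (label (sval c)).2).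
  have eb : base_table c' = base_table (sval c) by apply: globe_table_idc => // s; apply: z.
  have er : bar_part a c' = bar_part a (sval c).
    by apply: tableP => -[|j] b s //=; rewrite globe_table_idc // => t; apply: z.
  have e : sval (idc c) = c'.
    apply: clampE; apply/(coslice_okP mX) => //; split=> //.
    have [d1 d1'] := md_idc mX (base (sval c)); have [d2 d2'] := md_idc mX (bar (sval c)).
    split; first by rewrite [LHS]d1 db.
    + by rewrite [LHS]d2 dr.
    + by rewrite eb -t1 -d1'.
    + by rewrite eb er -t2 -d2'.
  split; first by rewrite /= -[LHS]/(gdim (sval (idc c))).+1 e.
  by rewrite /= e eb er.
- move=> n v u /(composableE tab)[].
  have A0 f : apex_table m 0 f [:: m] = 1 by rewrite /apex_table !eqxx.
  (* The two compatibility conditions at the vertex m of level 0 tell which kinds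
     of cells can be composed, and along which level. *)
  have mid0 n' : tcompat n' (cone_table v) (cone_table u) ->
     cone_table u 0 true [:: m] = cone_table v 0 (0 < n') [:: m].
    by case: n' => [|n'] [lo mid]; [apply: mid|apply: lo].
  have low0 n' : 0 < n' -> tcompat n' (cone_table v) (cone_table u) ->
     cone_table u 0 false [:: m] = cone_table v 0 false [:: m].
    by move=> lt [lo _]; apply: lo.
  case: v mid0 low0 => [y|b d|l] mid0 low0; case: u mid0 low0 => [x|a c|k] mid0 low0 ed lt cp;
    move: (mid0 n cp) (low0 n ^~ cp);
      rewrite {mid0 low0} /= ?old_apex ?join_apex ?A0 // => e1 e2.
  + by apply: (md_comp mX); apply/(composableE mX).
  + case: n lt cp e1 {e2} => [|//] lt cp _.
    exact: cone_comp_action.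
  + by case: n lt cp e1 {e2} => [//|n] lt cp _; apply: cone_comp_leg.
  + by case: n lt e1 e2 {cp} => [//|n] _ _ /(_ isT).
  + case: n e2 {e1 cp lt} => [_|n /(_ isT) //]; split=> //.
    apply: tableP => -[|j] b s; rewrite /tcomp //=; case: b => //.
    rewrite /cone_join /apex_table /=; case: ifP => // nl; case: (s =P [:: m]) => // es.
    by rewrite es /= eqxx in nl.
  + split=> //; apply: tableP => j b s; rewrite /tcomp.
    case: (ltngtP j n) => // [|->]; last by case: b.
    by case: j.
Qed.

End Cone.

(** The terminal omega-category has one vertex, and each cone adds one. *)
Lemma iter_cone_model n : exists tb, model n.+1 (X := iter n cone terminal) tb.
Proof.
elim: n => [|n [tb mtb]]; first by eexists; apply: model_terminal.
by eexists; apply: cone_model mtb.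
Qed.

Theorem theorem6 (n : nat) :
  [/\ is_omega_cat (iter n cone terminal),
      is_omega_cat (oriental n) &
      isomorphic (iter n cone terminal) (oriental n)].
Proof.
have [tb mtb] := iter_cone_model n; have mO := oriental_model n.
by split; [apply: model_omega_cat mtb|apply: model_omega_cat mO|apply: model_isomorphic mtb mO].
Qed.
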